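(* Let $E:\mathcal{P}_{2,\omega_0}(\mathbb{R}^d)\to\mathbb{R}\cup\{+\infty\}$ satisfy the domain assumption (every $\mu\in D(E)$ does not charge small sets) and the convexity assumption (proper, coercive, lower semicontinuous, and $\lambda$-convex along generalized geodesics) for some $\lambda\in\mathbb{R}$. Let $\mu\in D(E)$ and $0<\tau<\frac{1}{\lambda^-}$. Then $\nu$ is the unique minimizer of $\Phi(\tau,\mu;\cdot)$ if and only if $\frac{1}{\tau}(\mathbf{t}_{\nu}^{\mu}-\mathrm{id})\in\partial E(\nu)$ and this element is a strong subdifferential. Hence $J_\tau\mu$ is characterized by the fact that $\frac{1}{\tau}(\mathbf{t}_{J_\tau\mu}^{\mu}-\mathrm{id})\in\partial E(J_\tau\mu)$ is a strong subdifferential.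
   Context: Fix a probability measure $\omega_0$ on $\mathbb{R}^d$. For probability measures $\mu,\nu$, $\Gamma(\mu,\nu)$ is the set of couplings, $W_2(\mu,\nu)=\inf_{\boldsymbol\mu\in\Gamma(\mu,\nu)}(\int|x_1-x_2|^2d\boldsymbol\mu)^{1/2}$, and $\Gamma_0(\mu,\nu)$ the set of optimal couplings. $\mathcal{P}_{2,\omega_0}(\mathbb{R}^d)=\{\mu: W_2(\mu,\omega_0)<\infty\}$ with metric $W_2$. $\mathbf{t}\#\mu$ denotes push-forward, $\mathrm{id}$ the identity map, $\pi^i$, $\pi^{i,j}$ coordinate projections on products of $\mathbb{R}^d$. A measure does not charge small sets if it gives zero mass to sets of finite $(d-1)$-dimensional Hausdorff measure; then for any $\nu$ with $W_2(\mu,\nu)<\infty$ there is a $\mu$-a.e. unique optimal transport map $\mathbf{t}_\mu^\nu$ with $\mathbf{t}_\mu^\nu\#\mu=\nu$ and $W_2(\mu,\nu)=\|\mathrm{id}-\mathbf{t}_\mu^\nu\|_{L^2(\mu)}$. A transport plan from $\mu_0$ to $\mu_1$ with base $\omega$ is $\boldsymbol\omega\in\mathcal{P}((\mathbb{R}^d)^3)$ with $\pi^{1,2}\#\boldsymbol\omega\in\Gamma_0(\omega,\mu_0)$, $\pi^{1,3}\#\boldsymbol\omega\in\Gamma_0(\omega,\mu_1)$; it induces the generalized geodesic $\mu_\alpha=((1-\alpha)\pi^2+\alpha\pi^3)\#\boldsymbol\omega$, $\alpha\in[0,1]$, and the pseudo-Wasserstein distance $W_{2,\boldsymbol\omega}(\mu_0,\mu_1)=(\int|x_2-x_3|^2d\boldsymbol\omega)^{1/2}$.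 For $E:\mathcal{P}_{2,\omega_0}(\mathbb{R}^d)\to\mathbb{R}\cup\{+\infty\}$, $D(E)=\{E<\infty\}$. $E$ is proper if $D(E)\neq\emptyset$; coercive if there are $\tau_0>0$, $u_0$ with $\inf_v\{\frac{1}{2\tau_0}W_2^2(u_0,v)+E(v)\}>-\infty$; lower semicontinuous w.r.t. $W_2$; $\lambda$-convex along generalized geodesics if for all $\mu_0,\mu_1,\omega\in\mathcal{P}_{2,\omega_0}$ there is a generalized geodesic from $\mu_0$ to $\mu_1$ with base $\omega$, induced by some $\boldsymbol\omega$, with $E(\mu_\alpha)\le(1-\alpha)E(\mu_0)+\alpha E(\mu_1)-\alpha(1-\alpha)\frac{\lambda}{2}W_{2,\boldsymbol\omega}^2(\mu_0,\mu_1)$ for all $\alpha\in[0,1]$. $\lambda^-=\max\{0,-\lambda\}$ and $1/\lambda^-=+\infty$ if $\lambda^-=0$. $\Phi(\tau,\mu;\nu)=\frac{1}{2\tau}W_2^2(\mu,\nu)+E(\nu)$, $J_\tau\mu=\operatorname{argmin}_{\nu\in\mathcal{P}_{2,\omega_0}}\Phi(\tau,\mu;\nu)$ (well defined for $\mu\in\overline{D(E)}$, $0<\tau<1/\lambda^-$ under the convexity assumption). For $\mu\in D(E)$, $\boldsymbol\xi\in L^2(\mu;\mathbb{R}^d)$ belongs to the subdifferential $\partial E(\mu)$ if $E(\nu)-E(\mu)\ge\int\langle\boldsymbol\xi,\mathbf{t}_\mu^\nu-\mathrm{id}\rangle d\mu+\frac{\lambda}{2}W_2^2(\mu,\nu)$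 for all $\nu\in D(E)$; it is a strong subdifferential if moreover for all measurable $\mathbf{t}$, $E(\mathbf{t}\#\mu)-E(\mu)\ge\int\langle\boldsymbol\xi,\mathbf{t}-\mathrm{id}\rangle d\mu+o(\|\mathbf{t}-\mathrm{id}\|_{L^2(\mu)})$ as $\mathbf{t}\to\mathrm{id}$ in $L^2(\mu)$. *)

(* Defs.v *)
From HB Require Import structures.
From mathcomp Require Import all_boot all_order all_algebra.
From mathcomp Require Import all_classical all_reals all_analysis.
Set Implicit Arguments. Unset Strict Implicit. Unset Printing Implicit Defensive.
Import Order.TTheory GRing.Theory Num.Theory.
Import numFieldNormedType.Exports.
Local Open Scope classical_set_scope.
Local Open Scope ring_scope.

(* R^d with its Borel sigma-algebra (generated by the open sets of the
   product = Euclidean topology); points are row vectors 'rV[R]_d. *)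
Notation Rd R d := (g_sigma_algebraType (@open 'rV[R]_d)).

Section Wasserstein.
Variables (R : realType) (d : nat).
Local Notation T := (Rd R d).

Definition inner (x y : 'rV[R]_d) : R := \sum_i x ord0 i * y ord0 i.
Definition sqdist (x y : 'rV[R]_d) : R := \sum_i (x ord0 i - y ord0 i) ^+ 2.

(* ---- (d-1)-dimensional Hausdorff measure (up to normalization) ---- *)
Definition diam (A : set 'rV[R]_d) : \bar R :=
  ereal_sup [set (Num.sqrt (sqdist x y))%:E | x in A & y in A].

Definition hausdorff_pre (s : nat) (delta : R) (A : set 'rV[R]_d) : \bar R :=
  ereal_inf [set (\sum_(0 <= i <oo) (if C i == set0 then 0 else diam (C i) ^+ s))%E
            | C in [set C : nat -> set 'rV[R]_d |
                     A `<=` \bigcup_i C i /\ forall i, (diam (C i) <= delta%:E)%E]].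

Definition hausdorff (s : nat) (A : set 'rV[R]_d) : \bar R :=
  ereal_sup [set hausdorff_pre s delta A | delta in [set e : R | 0 < e]].

Definition no_small_sets (mu : probability T R) : Prop :=
  forall A : set T, measurable A -> (hausdorff d.-1 A < +oo)%E -> mu A = 0%E.

Definition pushes {d1 d2} {T1 : measurableType d1} {T2 : measurableType d2}
  (mu : probability T1 R) (f : T1 -> T2) (nu : probability T2 R) : Prop :=
  forall A : set T2, measurable A -> mu (f @^-1` A) = nu A.

Definition coupling (mu nu : probability T R) (p : probability (T * T)%type R) :=
  pushes p fst mu /\ pushes p snd nu.

Definition cost (p : probability (T * T)%type R) : \bar R :=
  (\int[p]_z (sqdist z.1 z.2)%:E)%E.

Definition W2sq (mu nu : probability T R) : \bar R :=
  ereal_inf [set cost p | p in [set p | coupling mu nu p]].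

Definition opt_coupling (mu nu : probability T R) (p : probability (T * T)%type R) :=
  coupling mu nu p /\ cost p = W2sq mu nu.

Definition P2 (omega0 mu : probability T R) : Prop := (W2sq mu omega0 < +oo)%E.

Definition otmap (mu nu : probability T R) (t : T -> T) : Prop :=
  measurable_fun setT t /\ pushes mu t nu /\
  (\int[mu]_x (sqdist x (t x))%:E)%E = W2sq mu nu.

Definition L2sq (mu : probability T R) (f g : T -> T) : \bar R :=
  (\int[mu]_x (sqdist (f x) (g x))%:E)%E.

Definition in_L2 (mu : probability T R) (xi : T -> T) : Prop :=
  measurable_fun setT xi /\ (L2sq mu xi (fun _ => 0%R : 'rV[R]_d) < +oo)%E.

Variable omega0 : probability T R.
Variable E : probability T R -> \bar R.

Definition domE (mu : probability T R) : Prop := P2 omega0 mu /\ (E mu < +oo)%E.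

Definition proper_fun : Prop := exists mu, domE mu.

Definition coercive : Prop :=
  exists tau0 : R, 0 < tau0 /\ exists u0, P2 omega0 u0 /\
    (ereal_inf [set (W2sq u0 v * ((2 * tau0)^-1)%:E + E v)%E | v in P2 omega0]
       > -oo)%E.

Definition lsc_W2 : Prop :=
  forall (mus : nat -> probability T R) (mu : probability T R),
    (forall n, P2 omega0 (mus n)) -> P2 omega0 mu ->
    (fun n => W2sq (mus n) mu) @ \oo --> 0%E ->
    (E mu <= limn_einf (fun n => E (mus n)))%E.

Definition transport_plan (om mu0 mu1 : probability T R)
  (W : probability (T * T * T)%type R) : Prop :=
  (exists p, pushes W (fun z => (z.1.1, z.1.2)) p /\ opt_coupling om mu0 p) /\
  (exists q, pushes W (fun z => (z.1.1, z.2)) q /\ opt_coupling om mu1 q).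

Definition W2plan_sq (W : probability (T * T * T)%type R) : \bar R :=
  (\int[W]_z (sqdist z.1.2 z.2)%:E)%E.

Definition interp (a : R) (z : T * T * T) : T :=
  ((1 - a) *: (z.1.2 : 'rV[R]_d) + a *: (z.2 : 'rV[R]_d)).

Definition gen_geod_convex (lambda : R) : Prop :=
  forall mu0 mu1 om, P2 omega0 mu0 -> P2 omega0 mu1 -> P2 omega0 om ->
  exists W, transport_plan om mu0 mu1 W /\
    forall a : R, 0 <= a <= 1 -> forall mua : probability T R, pushes W (interp a) mua ->
      (E mua <= (1 - a)%:E * E mu0 + a%:E * E mu1
                - (a * (1 - a) * (lambda / 2))%:E * W2plan_sq W)%E.

Definition subdiff (lambda : R) (mu : probability T R) (xi : T -> T) : Prop :=
  domE mu /\ in_L2 mu xi /\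
  forall nu t, domE nu -> otmap mu nu t ->
    (E nu - E mu >= \int[mu]_x (inner (xi x) (t x - x))%:E
                    + (lambda / 2)%:E * W2sq mu nu)%E.

Definition strong_subdiff (lambda : R) (mu : probability T R) (xi : T -> T) : Prop :=
  subdiff lambda mu xi /\
  forall eps : R, 0 < eps -> exists delta : R, 0 < delta /\
    forall (t : T -> T) (nu : probability T R),
      measurable_fun setT t -> pushes mu t nu ->
      (L2sq mu t id < (delta ^+ 2)%:E)%E ->
      (E nu - E mu >= \int[mu]_x (inner (xi x) (t x - x))%:E
                      - (eps * Num.sqrt (fine (L2sq mu t id)))%:E)%E.

Definition Phi (tau : R) (mu nu : probability T R) : \bar R :=
  (W2sq mu nu * ((2 * tau)^-1)%:E + E nu)%E.

(* measures are identified when they agree on measurable sets *)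
Definition same_measure (mu nu : probability T R) : Prop :=
  forall A : set T, measurable A -> mu A = nu A.

Definition unique_minimizer (tau : R) (mu nu : probability T R) : Prop :=
  P2 omega0 nu /\ (forall nu', P2 omega0 nu' -> (Phi tau mu nu <= Phi tau mu nu')%E) /\
  (forall nu', P2 omega0 nu' -> (forall nu'', P2 omega0 nu'' ->
      (Phi tau mu nu' <= Phi tau mu nu'')%E) -> same_measure nu' nu).

End Wasserstein.

(* Main.v *)
Require Import Defs.
From HB Require Import structures.
From mathcomp Require Import all_boot all_order all_algebra.
From mathcomp Require Import all_classical all_reals all_analysis.
From mathcomp Require Import measurable_realfun ring lra.
Set Implicit Arguments. Unset Strict Implicit. Unset Printing Implicit Defensive.
Import Order.TTheory GRing.Theory Num.Theory.
Import numFieldNormedType.Exports.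
Local Open Scope classical_set_scope.
Local Open Scope ring_scope.

(** Brenier's theorem reduces everything to maps.  If [g] is an optimal coupling,
    draw two independent samples [(x, y)], [(x', y')] of [g] and exchange the
    targets when [<x - x', y - y'> < 0]; by symmetry the result is again a
    coupling, strictly cheaper unless the exchange is [g \x g]-negligible.  Hence
    [g] lives on a closed monotone set, whose multivalued points lie on countably
    many Lipschitz graphs [|x_i - x'_i| <= L * sum_(j != i) |x_j - x'_j|].  A first
    marginal that does not charge small sets ignores them, so [g] is carried by
    the graph of a measurable map, common to all optimal couplings.

    Consequently a plan with base [mu] between [nu] and [nu'] is a segment of maps
    [(1 - a) id + a s] on [nu].  Inserting it in the strong subdifferential
    inequality and in the convexity inequality, then letting [a] tend to [0], gives
    [Phi nu' - Phi nu >= (lambda + 1 / tau) / 2 * |id - s|^2], whence minimality and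
    uniqueness.  Conversely, minimality tested on push-forwards [f # nu] gives the
    strong subdifferential inequality with error [|f - id|^2 / (2 * tau)], and tested
    on geodesics from [nu] it gives the global one. *)

(** * Borel maps and push-forwards *)

Section Rd_measurability.
Context (R : realType) (d : nat).
Local Notation T := (Rd R d).

(** Rational endpoints make these boxes a countable base of the topology, so that arguments on open
    sets reduce to countable unions. *)
Definition ratbox (ab : 'rV[rat]_d * 'rV[rat]_d) : set 'rV[R]_d :=
  [set x | forall i, ratr (ab.1 ord0 i) < x ord0 i < ratr (ab.2 ord0 i)].

Lemma nbhs_ratbox (x : 'rV[R]_d) (U : set 'rV[R]_d) : nbhs x U ->
  exists ab, ratbox ab x /\ ratbox ab `<=` U.
Proof.
case=> P xP PU.
have H (i : 'I_d) : exists qr : rat * rat,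
    ratr qr.1 < x ord0 i < ratr qr.2 /\
    [set y : R | ratr qr.1 < y < ratr qr.2] `<=` P ord0 i.
  have [e /= e0 eP] := (nbhs_ballP (x ord0 i) (P ord0 i)).1 (xP ord0 i).
  have [q] := @rat_in_itvoo R (x ord0 i - e) (x ord0 i) ltac:(lra).
  have [r] := @rat_in_itvoo R (x ord0 i) (x ord0 i + e) ltac:(lra).
  rewrite !in_itv/= => /andP[r1 r2] /andP[q1 q2].
  exists (q, r) => /=; split; first by rewrite q2 r1.
  move=> y /= /andP[y1 y2]; apply: eP.
  by rewrite /ball/= ltr_norml; apply/andP; split; lra.
have [f Hf] := choice H.
exists (\row_i (f i).1, \row_i (f i).2); split.
  by move=> i; rewrite !mxE; exact: (Hf i).1.
move=> y yf; apply: PU => i j; rewrite (ord1 i); apply: (Hf j).2 => /=.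
by have := yf j; rewrite !mxE.
Qed.

Lemma open_ratbox ab : open (ratbox ab).
Proof.
rewrite openE => x xab; rewrite /interior.
exists (fun _ j => [set y : R | ratr (ab.1 ord0 j) < y < ratr (ab.2 ord0 j)]); last first.
  by move=> y H j; exact: H.
move=> i j; rewrite ord1.
have /andP[h1 h2] := xab j.
by apply: filterS2 (lt_nbhsr h1) (lt_nbhsl h2) => y /= -> ->.
Qed.

Lemma open_measurable_Rd (U : set 'rV[R]_d) : open U -> measurable (U : set T).
Proof. by move=> oU; apply: sub_sigma_algebra. Qed.

Lemma closed_measurable_Rd (U : set 'rV[R]_d) : closed U -> measurable (U : set T).
Proof.
by move=> oU; rewrite -(setCK U); apply: measurableC; apply: open_measurable_Rd; rewrite openC.
Qed.

Lemma measurable_coord (i : 'I_d) :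
  measurable_fun setT (fun x : T => (x : 'rV[R]_d) ord0 i).
Proof.
apply: (measurability _ (RGenOInfty.measurableE R)) => _ [_ [a ->] <-].
rewrite setTI; apply: open_measurable_Rd.
apply: open_comp; last exact: rray_open.
by move=> x _; exact: coord_continuous.
Qed.

(** Every open set is a countable union of rational boxes, and the preimage of a box is a finite
    intersection of coordinate preimages. *)
Lemma measurable_rV d' (Om : measurableType d') (f : Om -> T) :
  (forall i, measurable_fun setT (fun x => (f x : 'rV[R]_d) ord0 i)) ->
  measurable_fun setT f.
Proof.
move=> mf; apply: (@measurability _ _ Om T setT f (@open 'rV[R]_d) erefl) => _ [U oU <-].
rewrite setTI.
have -> : f @^-1` U = \bigcup_(ab in [set ab | ratbox ab `<=` U]) f @^-1` (ratbox ab).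
  apply/seteqP; split => [x Ux|x [ab abU abx]]; last exact: abU.
  have [|ab [abx abU]] := @nbhs_ratbox (f x) U; first exact: open_nbhs_nbhs.
  by exists ab.
rewrite bigcup_mkcond; apply: countable_bigcupT_measurable => [|ab].
  exact: countableP.
case: ifP => // _.
have -> : f @^-1` ratbox ab = \bigcap_(i in [set: 'I_d]) ((fun x => (f x : 'rV[R]_d) ord0 i) @^-1`
   `](ratr (ab.1 ord0 i)), (ratr (ab.2 ord0 i))[%classic).
  apply/seteqP; split => x /= H i; first by move=> _ /=; rewrite in_itv; exact: H.
  by have := H i I; rewrite /= in_itv.
apply: fin_bigcap_measurable => [|i _]; first exact: finite_finset.
rewrite -[X in measurable X]setTI; exact: mf.
Qed.

End Rd_measurability.

Section Rd_measurable_fun.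
Context (R : realType) (d : nat) d' (Om : measurableType d').
Local Notation T := (Rd R d).
Implicit Types f g h : Om -> T.

Lemma measurable_coord_comp f i : measurable_fun setT f ->
  measurable_fun setT (fun x => (f x : 'rV[R]_d) ord0 i).
Proof. by move=> mf; apply: (measurableT_comp (measurable_coord i) mf). Qed.

Lemma measurable_sqdist f g : measurable_fun setT f -> measurable_fun setT g ->
  measurable_fun setT (fun x => sqdist (f x) (g x)).
Proof.
move=> mf mg; apply: measurable_sum => i.
by apply: measurable_funX; apply: measurable_funB; exact: measurable_coord_comp.
Qed.

Lemma measurable_inner f g : measurable_fun setT f -> measurable_fun setT g ->
  measurable_fun setT (fun x => inner (f x) (g x)).
Proof.
move=> mf mg; apply: measurable_sum => i.
by apply: measurable_funM; exact: measurable_coord_comp.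
Qed.

Lemma measurable_rVB f g : measurable_fun setT f -> measurable_fun setT g ->
  measurable_fun setT (fun x => (f x : 'rV[R]_d) - g x : T).
Proof.
move=> mf mg; apply: measurable_rV => i.
under eq_fun do rewrite !mxE.
by apply: measurable_funB; exact: measurable_coord_comp.
Qed.

Lemma measurable_rVD f g : measurable_fun setT f -> measurable_fun setT g ->
  measurable_fun setT (fun x => (f x : 'rV[R]_d) + g x : T).
Proof.
move=> mf mg; apply: measurable_rV => i.
under eq_fun do rewrite !mxE.
by apply: measurable_funD; exact: measurable_coord_comp.
Qed.

Lemma measurable_rVZ (c : R) f : measurable_fun setT f ->
  measurable_fun setT (fun x => c *: (f x : 'rV[R]_d) : T).
Proof.
move=> mf; apply: measurable_rV => i.
under eq_fun do rewrite !mxE.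
by apply: measurable_funM => //; exact: measurable_coord_comp.
Qed.

End Rd_measurable_fun.

Section unit_mass.
Context (R : realType) d1 (T1 : measurableType d1).
Variables (m : {measure set T1 -> \bar R}) (m1 : m setT = 1%E).

Definition unit_mass (h : m setT = 1%E) : set T1 -> \bar R := m.

HB.instance Definition _ := Measure.copy (unit_mass m1) m.

HB.instance Definition _ := Measure_isProbability.Build _ _ _ (unit_mass m1) m1.

End unit_mass.

Section pushes.
Context (R : realType) d1 d2 (T1 : measurableType d1) (T2 : measurableType d2).
Implicit Types (P : probability T1 R) (Q : probability T2 R) (f : T1 -> T2).

Lemma pushforward_probability (m : {measure set T1 -> \bar R}) f :
  m setT = 1%E -> measurable_fun setT f ->
  exists Q : probability T2 R, forall A, Q A = m (f @^-1` A).
Proof.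
move=> m1 mf.
pose mfP := isMeasurableFun.Build _ _ _ _ f mf.
pose F : {mfun T1 >-> T2} := HB.pack f mfP.
by exists (distribution (unit_mass m1) F).
Qed.

Lemma pushes_exists P f : measurable_fun setT f -> exists Q, pushes P f Q.
Proof.
move=> mf; have [Q QE] := pushforward_probability (@probability_setT _ _ _ P) mf.
by exists Q => A mA; rewrite QE.
Qed.

Lemma ge0_integral_pushes_in P f Q D (g : T2 -> \bar R) : pushes P f Q ->
  measurable_fun setT f -> measurable D -> measurable_fun D g -> (forall x, 0 <= g x)%E ->
  (\int[Q]_(y in D) g y = \int[P]_(x in f @^-1` D) g (f x))%E.
Proof.
move=> PQ mf mD mg g0.
rewrite (eq_measure_integral (pushforward P f)); last by move=> A mA _; exact/esym/PQ.
by rewrite (ge0_integral_pushforward mf)// => y _; exact: g0.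
Qed.

Lemma ge0_integral_pushes P f Q (g : T2 -> \bar R) : pushes P f Q ->
  measurable_fun setT f -> measurable_fun setT g -> (forall x, 0 <= g x)%E ->
  (\int[Q]_y g y = \int[P]_x g (f x))%E.
Proof. by move=> PQ mf mg g0; rewrite (ge0_integral_pushes_in PQ). Qed.

Lemma ae_pushes P f Q (S : T2 -> Prop) : pushes P f Q -> measurable_fun setT f ->
  {ae Q, forall y, S y} -> {ae P, forall x, S (f x)}.
Proof.
move=> PQ mf [N [mN N0 SN]]; exists (f @^-1` N); split.
- by rewrite -[X in measurable X]setTI; exact: mf.
- by rewrite PQ.
- by move=> x /= Sx; exact: SN.
Qed.

End pushes.

(** * Squared distances and the Wasserstein cost *)

Section sqdist_algebra.
Context (R : realType) (d : nat).
Implicit Types x y z : 'rV[R]_d.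

Lemma sqdist_ge0 x y : 0 <= sqdist x y.
Proof. by apply: sumr_ge0 => i _; exact: sqr_ge0. Qed.

Lemma sqdistC x y : sqdist x y = sqdist y x.
Proof. by apply: eq_bigr => i _; rewrite -sqrrN opprB. Qed.

Lemma sqdistxx x : sqdist x x = 0.
Proof. by rewrite /sqdist big1 // => i _; rewrite subrr expr0n. Qed.

Lemma sqdist_eq0 x y : sqdist x y = 0 -> x = y.
Proof.
move=> /psumr_eq0P H; apply/rowP => i.
have /eqP := H (fun i _ => sqr_ge0 _) i isT.
by rewrite sqrf_eq0 subr_eq0 => /eqP.
Qed.

(** Through three squared distances, integrability and the integral of the inner product follow from
    finite transport costs. *)
Lemma inner_polarization x y z :
  inner (x - y) (z - y) = 2^-1 * sqdist x y + 2^-1 * sqdist y z + - 2^-1 * sqdist x z.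
Proof.
rewrite /inner /sqdist !mulr_sumr -!big_split /=.
by apply: eq_bigr => i _; rewrite !mxE; field.
Qed.

Lemma innerZ (a b : R) x y : inner (a *: x) (b *: y) = a * b * inner x y.
Proof.
by rewrite /inner mulr_sumr; apply: eq_bigr => i _; rewrite !mxE; ring.
Qed.

Lemma sqdistZ0 (a : R) x y : sqdist (a *: (x - y)) 0 = a ^+ 2 * sqdist x y.
Proof.
by rewrite /sqdist mulr_sumr; apply: eq_bigr => i _; rewrite !mxE; ring.
Qed.

Lemma sqdist_triangle x y z : sqdist x z <= 2 * sqdist x y + 2 * sqdist y z.
Proof.
rewrite /sqdist !mulr_sumr -big_split /=; apply: ler_sum => i _.
have := sqr_ge0 (x ord0 i - y ord0 i - (y ord0 i - z ord0 i)); nra.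
Qed.

(** Exact form of the convexity of the squared distance; its quadratic term is what later adds
    [1 / tau] to [lambda]. *)
Lemma sqdist_interp (a : R) x y z :
  sqdist z ((1 - a) *: x + a *: y) =
  (1 - a) * sqdist z x + a * sqdist z y + - (a * (1 - a)) * sqdist x y.
Proof.
rewrite /sqdist !mulr_sumr -!big_split /=.
by apply: eq_bigr => i _; rewrite !mxE; ring.
Qed.

(** Exchanging targets changes the cost by twice an inner product, so it pays exactly when that
    product is negative. *)
Lemma sqdist_swap x y x' y' :
  sqdist x y' + sqdist x' y = sqdist x y + sqdist x' y' + 2 * inner (x - x') (y - y').
Proof.
rewrite /inner /sqdist !mulr_sumr -!big_split /=.
by apply: eq_bigr => i _; rewrite !mxE; ring.
Qed.

End sqdist_algebra.

Section integral_sqdist.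
Context (R : realType) (d : nat) d' (Om : measurableType d') (P : probability Om R).
Local Notation T := (Rd R d).
Implicit Types X Y Z : Om -> T.

Lemma measurable_sqdistE X Y : measurable_fun setT X -> measurable_fun setT Y ->
  measurable_fun setT (fun w => (sqdist (X w) (Y w))%:E).
Proof. by move=> mX mY; apply/measurable_EFinP; exact: measurable_sqdist. Qed.

Lemma integral_sqdist_ge0 X Y : (0 <= \int[P]_w (sqdist (X w) (Y w))%:E)%E.
Proof. by apply: integral_ge0 => w _; rewrite lee_fin sqdist_ge0. Qed.

Lemma integrable_sqdist X Y : measurable_fun setT X -> measurable_fun setT Y ->
  (\int[P]_w (sqdist (X w) (Y w))%:E < +oo)%E ->
  P.-integrable setT (fun w => (sqdist (X w) (Y w))%:E).
Proof.
move=> mX mY foo; apply/integrableP; split; first exact: measurable_sqdistE.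
by under eq_integral do rewrite gee0_abs ?lee_fin ?sqdist_ge0//.
Qed.

Lemma integral_sqdist_fin X Y : (\int[P]_w (sqdist (X w) (Y w))%:E < +oo)%E ->
  (\int[P]_w (sqdist (X w) (Y w))%:E)%E =
  (fine (\int[P]_w (sqdist (X w) (Y w))%:E))%:E.
Proof. by move=> foo; rewrite fineK// ge0_fin_numE// integral_sqdist_ge0. Qed.

Lemma integral_sqdist_triangle X Y Z :
  measurable_fun setT X -> measurable_fun setT Y -> measurable_fun setT Z ->
  (\int[P]_w (sqdist (X w) (Y w))%:E < +oo)%E ->
  (\int[P]_w (sqdist (Y w) (Z w))%:E < +oo)%E ->
  (\int[P]_w (sqdist (X w) (Z w))%:E < +oo)%E.
Proof.
move=> mX mY mZ XY YZ.
have iXY := integrable_sqdist mX mY XY; have iYZ := integrable_sqdist mY mZ YZ.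
have i2 := integrableD measurableT (integrableZl measurableT 2 iXY)
             (integrableZl measurableT 2 iYZ).
apply: le_lt_trans (integrable_lty measurableT i2).
apply: ge0_le_integral => //.
- by move=> w _; rewrite lee_fin sqdist_ge0.
- exact: measurable_sqdistE.
- by have /integrableP[] := i2.
- by move=> w _; rewrite /= -!EFinM -EFinD lee_fin sqdist_triangle.
Qed.

Lemma integrable_lin3 (a b c : R) (f g h : Om -> R) :
  P.-integrable setT (EFin \o f) -> P.-integrable setT (EFin \o g) ->
  P.-integrable setT (EFin \o h) ->
  P.-integrable setT (fun w => (a * f w + b * g w + c * h w)%:E).
Proof.
move=> i1 i2 i3.
exact: (integrableD measurableT (integrableD measurableT
  (integrableZl measurableT a i1) (integrableZl measurableT b i2))
  (integrableZl measurableT c i3)).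
Qed.

Lemma integral_lin3 (a b c : R) (f g h : Om -> R) :
  P.-integrable setT (EFin \o f) -> P.-integrable setT (EFin \o g) ->
  P.-integrable setT (EFin \o h) ->
  (\int[P]_w (a * f w + b * g w + c * h w)%:E)%E =
  (a * fine (\int[P]_w (f w)%:E) + b * fine (\int[P]_w (g w)%:E)
   + c * fine (\int[P]_w (h w)%:E))%:E.
Proof.
move=> i1 i2 i3.
have j1 := integrableZl measurableT a i1.
have j2 := integrableZl measurableT b i2.
have j3 := integrableZl measurableT c i3.
rewrite !EFinD !EFinM !fineK; try exact: integrable_fin_num.
rewrite -!(integralZl measurableT)//.
rewrite -(integralD measurableT j1 j2) -(integralD measurableT _ j3)//.
exact: integrableD.
Qed.

Lemma integrable_inner X Y Z :
  measurable_fun setT X -> measurable_fun setT Y -> measurable_fun setT Z ->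
  (\int[P]_w (sqdist (X w) (Y w))%:E < +oo)%E ->
  (\int[P]_w (sqdist (Y w) (Z w))%:E < +oo)%E ->
  P.-integrable setT (fun w =>
    (inner (X w - Y w : 'rV[R]_d) (Z w - Y w : 'rV[R]_d))%:E).
Proof.
move=> mX mY mZ XY YZ; have XZ := integral_sqdist_triangle mX mY mZ XY YZ.
under eq_fun do rewrite inner_polarization.
by apply: integrable_lin3; exact: integrable_sqdist.
Qed.

Lemma integral_inner X Y Z :
  measurable_fun setT X -> measurable_fun setT Y -> measurable_fun setT Z ->
  (\int[P]_w (sqdist (X w) (Y w))%:E < +oo)%E ->
  (\int[P]_w (sqdist (Y w) (Z w))%:E < +oo)%E ->
  (\int[P]_w (inner (X w - Y w : 'rV[R]_d) (Z w - Y w : 'rV[R]_d))%:E)%E =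
  (2^-1 * (fine (\int[P]_w (sqdist (X w) (Y w))%:E)
           + fine (\int[P]_w (sqdist (Y w) (Z w))%:E)
           - fine (\int[P]_w (sqdist (X w) (Z w))%:E)))%:E.
Proof.
move=> mX mY mZ XY YZ; have XZ := integral_sqdist_triangle mX mY mZ XY YZ.
under eq_integral do rewrite inner_polarization.
rewrite integral_lin3; [|exact: integrable_sqdist..].
by congr EFin; ring.
Qed.

Lemma integral_sqdist_eq0 X Y : measurable_fun setT X -> measurable_fun setT Y ->
  (\int[P]_w (sqdist (X w) (Y w))%:E = 0)%E -> {ae P, forall w, X w = Y w}.
Proof.
move=> mX mY XY0.
have [N [mN N0 sN]] : ae_eq P setT (fun w => (sqdist (X w) (Y w))%:E) (cst 0%E).
  apply/(ae_eq_integral_abs _ measurableT (measurable_sqdistE mX mY)).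
  by under eq_integral do rewrite gee0_abs ?lee_fin ?sqdist_ge0//.
exists N; split => // w /= XYw; apply: sN => /= H; apply: XYw; apply: sqdist_eq0.
by have [] := H I.
Qed.

End integral_sqdist.

Section W2sq_theory.
Context (R : realType) (d : nat).
Local Notation T := (Rd R d).
Implicit Types mu nu : probability T R.

Lemma pushes_pair d' (Om : measurableType d') (P : probability Om R)
    (X Y : Om -> T) mu nu :
  measurable_fun setT X -> measurable_fun setT Y ->
  pushes P X mu -> pushes P Y nu ->
  exists p, [/\ pushes P (fun w => (X w, Y w)) p, coupling mu nu p &
    cost p = (\int[P]_w (sqdist (X w) (Y w))%:E)%E].
Proof.
move=> mX mY PX PY.
have mXY := measurable_fun_pair mX mY.
have [p Pp] := pushes_exists P mXY.
exists p; split => //.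
- split => A mA.
    rewrite -Pp; first by rewrite -PX.
    by rewrite -[X in measurable X]setTI; exact: measurable_fst.
  rewrite -Pp; first by rewrite -PY.
  by rewrite -[X in measurable X]setTI; exact: measurable_snd.
- rewrite /cost (ge0_integral_pushes Pp)//; first exact: measurable_sqdistE.
  by move=> z; rewrite lee_fin sqdist_ge0.
Qed.

Lemma W2sq_le d' (Om : measurableType d') (P : probability Om R)
    (X Y : Om -> T) mu nu :
  measurable_fun setT X -> measurable_fun setT Y ->
  pushes P X mu -> pushes P Y nu ->
  (W2sq mu nu <= \int[P]_w (sqdist (X w) (Y w))%:E)%E.
Proof.
move=> mX mY PX PY; have [p [_ cp <-]] := pushes_pair mX mY PX PY.
by apply: ereal_inf_lbound; exists p.
Qed.

Lemma W2sq_ge0 mu nu : (0 <= W2sq mu nu)%E.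
Proof.
apply: le_ereal_inf_tmp => _ [p _ <-].
by apply: integral_ge0 => w _; rewrite lee_fin sqdist_ge0.
Qed.

Lemma W2sqC mu nu : W2sq mu nu = W2sq nu mu.
Proof.
have H (m n : probability T R) : (W2sq m n <= W2sq n m)%E.
  apply: le_ereal_inf_tmp => _ [p [p1 p2] <-].
  have := W2sq_le measurable_snd measurable_fst p2 p1.
  by under eq_integral do rewrite sqdistC.
by apply/eqP; rewrite eq_le !H.
Qed.

Lemma W2sqxx mu : W2sq mu mu = 0%E.
Proof.
apply/eqP; rewrite eq_le W2sq_ge0 andbT.
have := @W2sq_le _ _ mu id id mu mu (@measurable_id _ _ _) (@measurable_id _ _ _)
  (fun _ _ => erefl) (fun _ _ => erefl).
by under eq_integral do rewrite sqdistxx; rewrite integral0.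
Qed.

Lemma opt_coupling_swap mu nu p : opt_coupling mu nu p ->
  exists q, pushes p (fun z => (z.2, z.1)) q /\ opt_coupling nu mu q.
Proof.
move=> [[p1 p2] cp].
have [q [pq cq qE]] := pushes_pair measurable_snd measurable_fst p2 p1.
exists q; split => //; split => //.
by rewrite qE W2sqC -cp /cost; under eq_integral do rewrite sqdistC.
Qed.

Lemma opt_coupling_otmap mu nu t : otmap mu nu t ->
  exists q, pushes mu (fun x => (x, t x)) q /\ opt_coupling mu nu q.
Proof.
move=> [mt [tmu tE]].
have [q [pq cq qE]] := pushes_pair (@measurable_id _ _ _) mt (fun _ _ => erefl) tmu.
by exists q; split => //; split => //; rewrite qE.
Qed.

End W2sq_theory.

(** * Hausdorff measure of Lipschitz graphs *)

Section lipschitz_graph_hausdorff.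
Context (R : realType).

Lemma lee_expe2r (n : nat) (x y : \bar R) : (0 <= x)%E -> (x <= y)%E ->
  (x ^+ n <= y ^+ n)%E.
Proof.
move=> x0 xy; elim: n => [|n IH]; first by rewrite !expe0.
by rewrite !expeS lee_pmul// expe_ge0.
Qed.

Lemma sum_sqr_le_sqr_sum_norm (n : nat) (a : 'I_n -> R) :
  \sum_i a i ^+ 2 <= (\sum_i `|a i|) ^+ 2.
Proof.
elim: n a => [|n IH] a; first by rewrite !big_ord0 expr0n.
rewrite !big_ord_recl.
have := IH (fun i => a (lift ord0 i)).
have : 0 <= \sum_i `|a (lift ord0 i)| by apply: sumr_ge0.
move: (\sum_i `|_|) (\sum_i _ ^+ 2) => s q s0 qs.
have := normr_ge0 (a ord0); rewrite -(real_normK (num_real (a ord0))).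
move: `|a ord0| => b b0; nra.
Qed.

Lemma grid_cell (h u : R) (m : nat) : 0 <= u -> u <= h * m.+1%:R ->
  exists k : 'I_m.+1, h * k%:R <= u <= h * k.+1%:R.
Proof.
move=> u0; elim: m => [|m IH] um.
  by exists ord0; rewrite mulr0 u0.
have [/IH[k hk]|hu] := lerP u (h * m.+1%:R).
  by exists (widen_ord (leqnSn _) k).
by exists ord_max; rewrite /= (ltW hu).
Qed.

Lemma nneseries_ord_le (f : nat -> \bar R) (c : nat) (v : R) : 0 <= v ->
  (forall k, 0 <= f k)%E -> (forall k, (k < c)%N -> (f k <= v%:E)%E) ->
  (forall k, (c <= k)%N -> f k = 0%E) ->
  (\sum_(0 <= k <oo) f k <= (c%:R * v)%:E)%E.
Proof.
move=> v0 f0 fv fc; apply: lime_le; first by exact: is_cvg_nneseries.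
apply: nearW => m.
suff : (\sum_(0 <= k < m) f k <= ((minn m c)%:R * v)%:E)%E.
  by move=> /le_trans; apply; rewrite lee_fin ler_wpM2r// ler_nat geq_minr.
elim: m => [|m IH]; first by rewrite big_geq// min0n mul0r.
rewrite big_nat_recr//=; have [cm|mc] := leqP c m.
  rewrite fc// adde0; apply: (le_trans IH).
  by rewrite (minn_idPr cm) (minn_idPr (leqW cm)).
rewrite (minn_idPl mc) -natr1 mulrDl mul1r EFinD; apply: leeD; last exact: fv.
by apply: (le_trans IH); rewrite (minn_idPl (ltnW mc)).
Qed.

(** Cut the range of the other [n] coordinates into [N ^ n] cells. The Lipschitz bound confines the
    part of [A] above a cell to diameter [K / N], so the covering sum is at most
    [N ^ n * (K / N) ^ n = K ^ n], whatever the scale [delta]. *)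
Lemma hausdorff_lipschitz_graph (n : nat) (A : set 'rV[R]_n.+1) (i : 'I_n.+1) (L M : R) :
  0 <= L -> 0 <= M ->
  (forall x j, A x -> `|x ord0 j| <= M) ->
  (forall x y, A x -> A y -> `|x ord0 i - y ord0 i| <=
     L * \sum_(j < n) `|x ord0 (lift i j) - y ord0 (lift i j)|) ->
  (hausdorff n A < +oo)%E.
Proof.
(* On a cell of side [2 * M / N] the [n] free coordinates vary by at most [n * 2 * M / N] in total
   and coordinate [i] by [L] times that; the sum [K / N] dominates the Euclidean diameter. *)
move=> L0 M0 AM AL; pose K := (1 + L) * (n%:R * (2 * M)).
have K0 : 0 <= K by rewrite /K !mulr_ge0// addr_ge0.
apply: (@le_lt_trans _ _ (K ^+ n)%:E); last exact: ltry.
apply: ge_ereal_sup => _ [delta /= delta0 <-].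
have [m Km] : exists m : nat, K / m.+1%:R <= delta.
  exists (Num.truncn (K / delta)).
  rewrite ler_pdivrMr ?ltr0n// mulrC -ler_pdivrMr//.
  exact/ltW/truncnS_gt.
set N := m.+1; pose h := 2 * M / N%:R.
have N0 : 0 < N%:R :> R by rewrite ltr0n.
have h0 : 0 <= h by rewrite /h divr_ge0// mulr_ge0.
pose J : finType := {ffun 'I_n -> 'I_N}.
pose piece (f : J) := [set x | A x /\ forall j : 'I_n,
  h * (f j)%:R <= x ord0 (lift i j) + M <= h * (f j).+1%:R].
(* The pieces are listed as a sequence, empty from index [#|J|] on; empty sets add nothing to the
   covering sum. *)
pose C k := if insub k is Some o then piece (@enum_val J predT o) else set0.
have diamP f : (diam (piece f) <= (K / N%:R)%:E)%E.
  apply: ge_ereal_sup => _ [x [Ax xf] [y [Ay yf] <-]]; rewrite lee_fin.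
  have xy j : `|x ord0 (lift i j) - y ord0 (lift i j)| <= h.
    have := xf j; have := yf j; rewrite -natr1 mulrDr mulr1 ler_norml.
    by move=> /andP[? ?] /andP[? ?]; apply/andP; split; lra.
  have S1 : \sum_(j < n) `|x ord0 (lift i j) - y ord0 (lift i j)| <= n%:R * h.
    apply: le_trans (ler_sum _ (fun j _ => xy j)) _.
    by rewrite sumr_const card_ord mulr_natl.
  have S2 : \sum_j `|x ord0 j - y ord0 j| <= K / N%:R.
    rewrite (bigD1_ord i)//= (_ : K / N%:R = L * (n%:R * h) + n%:R * h).
      by apply: lerD => //; apply: le_trans (AL _ _ Ax Ay) _; rewrite ler_wpM2l.
    by rewrite /K /h; field; rewrite gt_eqF.
  have S0 : 0 <= \sum_j `|x ord0 j - y ord0 j| by apply: sumr_ge0.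
  apply: le_trans S2; rewrite -[leRHS]ger0_norm// -sqrtr_sqr.
  exact/ler_wsqrtr/sum_sqr_le_sqr_sum_norm.
have diam0 (B : set 'rV[R]_n.+1) : B != set0 -> (0 <= diam B)%E.
  move=> /set0P[x Bx]; apply: (@le_trans _ _ (Num.sqrt (sqdist x x))%:E).
    by rewrite lee_fin sqrtr_ge0.
  by apply: ereal_sup_ubound; exists x => //; exists x.
have set0d (e : R) : 0 <= e -> (diam (set0 : set 'rV[R]_n.+1) <= e%:E)%E.
  by move=> e0; apply: ge_ereal_sup => _ [x []].
apply: ge_ereal_inf; eexists.
  exists C => //; split.
    move=> x Ax.
    have /choice[f fP] : forall j : 'I_n, exists k : 'I_N,
        h * k%:R <= x ord0 (lift i j) + M <= h * k.+1%:R.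
      move=> j; have := AM x (lift i j) Ax; rewrite ler_norml => /andP[H1 H2].
      apply: grid_cell; first lra.
      by rewrite /h divfK ?gt_eqF//; lra.
    exists (@enum_rank J (finfun f)) => //.
    rewrite /C; case: insubP => [r _ rE|]; last by rewrite ltn_ord.
    have -> : r = enum_rank (finfun f : J) by exact: val_inj.
    by rewrite enum_rankK; split=> // j; rewrite ffunE.
  move=> k; rewrite /C; case: insubP => [r _ _|_]; last exact/set0d/ltW.
  by apply: le_trans (diamP _) _; rewrite lee_fin.
have -> : K ^+ n = #|J|%:R * (K / N%:R) ^+ n.
  rewrite card_ffun !card_ord natrX -exprMn; congr (_ ^+ n).
  by field; rewrite gt_eqF.
apply: nneseries_ord_le.
- by rewrite exprn_ge0// divr_ge0// ltW.
- by move=> k; case: ifPn => // /diam0 ?; rewrite expe_ge0.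
- move=> k _; case: ifPn => [_|/diam0 Ck].
    by rewrite lee_fin exprn_ge0// divr_ge0// ltW.
  rewrite EFin_expe; apply: lee_expe2r => //.
  rewrite /C; case: insubP => [r _ _|_]; first exact: diamP.
  by apply: set0d; rewrite divr_ge0// ltW.
- move=> k Jk; rewrite /C insubN -?leqNgt//.
  by rewrite eqxx.
Qed.

End lipschitz_graph_hausdorff.

(** * Optimal couplings are carried by maps *)

Section optimal_monotone.
Context (R : realType) (d : nat).
Local Notation T := (Rd R d).
Local Notation T4 := ((T * T) * (T * T))%type.
Implicit Types mu nu : probability T R.
Implicit Types g : probability (T * T)%type R.

Definition cross (zz : T4) : R :=
  inner (zz.1.1 - zz.2.1 : 'rV[R]_d) (zz.1.2 - zz.2.2 : 'rV[R]_d).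

Let sw (zz : T4) : T4 := (zz.2, zz.1).

Lemma measurable_cross : measurable_fun setT cross.
Proof.
apply: measurable_inner; apply: measurable_rVB.
- exact: measurableT_comp measurable_fst measurable_fst.
- exact: measurableT_comp measurable_fst measurable_snd.
- exact: measurableT_comp measurable_snd measurable_fst.
- exact: measurableT_comp measurable_snd measurable_snd.
Qed.

Lemma cross_sw zz : cross (sw zz) = cross zz.
Proof.
by rewrite /cross /inner; apply: eq_bigr => i _; rewrite !mxE; ring.
Qed.

Let msw : measurable_fun setT sw.
Proof. exact: measurable_fun_pair. Qed.

(** Both measures agree on rectangles, which determine the product. *)
Lemma product_measure_swap g A : measurable A -> (g \x g)%E (sw @^-1` A) = (g \x g)%E A.
Proof.
move=> mA; apply/esym.
apply: (@product_measure_unique _ _ _ _ R g g (pushforward (g \x g)%E sw)) => //.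
move=> B C mB mC.
have E : sw @^-1` (B `*` C) = C `*` B by apply/seteqP; split => -[z z'] [].
by rewrite -[LHS]/((g \x g)%E (sw @^-1` (B `*` C))) E product_measure1E// muleC.
Qed.

(* Two independent samples of an optimal coupling [g] exchange their targets
   exactly when this strictly lowers the cost; by symmetry the result is again
   a coupling, so optimality forces the exchange to be negligible. *)
Lemma optimal_cross_null mu nu g : opt_coupling mu nu g -> (W2sq mu nu < +oo)%E ->
  (g \x g)%E [set zz | cross zz < 0] = 0%E.
Proof.
move=> [[g1 g2] gE] Woo.
have m1 : (g \x g)%E setT = 1%E.
  transitivity (g setT * g setT)%E; last by rewrite probability_setT mule1.
  by rewrite -setXTT; exact: product_measure1E.
pose PP : probability T4 R := unit_mass m1.
set S := [set zz | cross zz < 0].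
have mS : measurable S.
  have := measurable_fun_ltr measurable_cross (@measurable_cst _ _ _ _ setT (0 : R)).
  by move=> /(_ measurableT [set true]); rewrite setTI; apply.
have mxx : measurable_fun setT (fun zz : T4 => zz.1.1).
  exact: measurableT_comp measurable_fst measurable_fst.
have mxy : measurable_fun setT (fun zz : T4 => zz.1.2).
  exact: measurableT_comp measurable_snd measurable_fst.
have mx'x : measurable_fun setT (fun zz : T4 => zz.2.1).
  exact: measurableT_comp measurable_fst measurable_snd.
have mx'y : measurable_fun setT (fun zz : T4 => zz.2.2).
  exact: measurableT_comp measurable_snd measurable_snd.
pose Y (zz : T4) : T := if cross zz < 0 then zz.2.2 else zz.1.2.
have mY : measurable_fun setT Y.
  apply: measurable_fun_ifT => //.
  exact: measurable_fun_ltr measurable_cross (@measurable_cst _ _ _ _ setT (0 : R)).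
have PPfst : pushes PP fst g.
  move=> A mA; rewrite (_ : fst @^-1` A = A `*` setT).
    transitivity (g A * g setT)%E; last by rewrite probability_setT mule1.
    exact: product_measure1E.
  by apply/seteqP; split => -[z z'] //= -[].
have PPsw : pushes PP sw PP by move=> A mA; exact: product_measure_swap.
have Ssw : sw @^-1` S = S by apply/seteqP; split => zz; rewrite /S /= cross_sw.
have mpre (f : T4 -> T) A : measurable_fun setT f -> measurable A -> measurable (f @^-1` A).
  by move=> mf mA; rewrite -[X in measurable X]setTI; exact: mf.
have PX : pushes PP (fun zz => zz.1.1) mu.
  move=> A mA; rewrite -g1// -PPfst//.
  by rewrite -[X in measurable X]setTI; exact: measurable_fst.
have PY0 : pushes PP (fun zz => zz.1.2) nu.
  move=> A mA; rewrite -g2// -PPfst//.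
  by rewrite -[X in measurable X]setTI; exact: measurable_snd.
(* [S] and the product measure are invariant under swapping the samples, so on [S] the two targets
   have the same law; off [S] nothing changes. *)
have PY : pushes PP Y nu.
  move=> A mA; rewrite -PY0//.
  have split2 (B : set T4) : measurable B -> PP B = (PP (B `&` S) + PP (B `\` S))%E.
    move=> mB; rewrite -measureU//.
    - by rewrite setUIDK.
    - exact: measurableI.
    - exact: measurableD.
    - by rewrite setIACA setICr setI0.
  rewrite (split2 (Y @^-1` A))//; last exact: mpre.
  rewrite [RHS]split2; last exact: mpre.
  congr (_ + _)%E.
    rewrite -[LHS]PPsw; last by apply: measurableI => //; exact: mpre.
    congr (PP _); rewrite preimage_setI Ssw; apply/seteqP; split => zz /= [H Hs];
      by move: H; rewrite /Y cross_sw Hs.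
  congr (PP _); apply/seteqP; split => zz /= [H Hs]; split => //; move: H;
    by rewrite /Y (negbTE (introN idP Hs)).
have Wle := W2sq_le mxx mY PX PY.
have WE : W2sq mu nu = (\int[PP]_zz (sqdist zz.1.1 zz.1.2)%:E)%E.
  rewrite -gE /cost (ge0_integral_pushes PPfst)//.
    exact: measurable_sqdistE measurable_fst measurable_snd.
  by move=> z; rewrite lee_fin sqdist_ge0.
have mm (X Z : T4 -> T) (D : set T4) : measurable_fun setT X -> measurable_fun setT Z ->
   measurable_fun D (fun zz => (sqdist (X zz) (Z zz))%:E).
  by move=> mX mZ; apply: (@measurable_funS _ _ _ _ setT) => //; exact: measurable_sqdistE.
have split3 (X Z : T4 -> T) : measurable_fun setT X -> measurable_fun setT Z ->
  (\int[PP]_zz (sqdist (X zz) (Z zz))%:E =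
   \int[PP]_(zz in S) (sqdist (X zz) (Z zz))%:E +
   \int[PP]_(zz in ~` S) (sqdist (X zz) (Z zz))%:E)%E.
  move=> mX mZ; rewrite -(setUv S) ge0_integral_setU//.
  - exact: measurableC.
  - exact: mm.
  - by move=> zz _; rewrite lee_fin sqdist_ge0.
  - by rewrite disj_set2E setICr.
have swS (f : T4 -> \bar R) : measurable_fun setT f -> (forall zz, 0 <= f zz)%E ->
  (\int[PP]_(zz in S) f zz = \int[PP]_(zz in S) f (sw zz))%E.
  move=> mf f0.
  rewrite (ge0_integral_pushes_in PPsw msw mS _ f0) ?Ssw//.
  exact: measurable_funS mf.
move: Wle; rewrite WE (split3 _ _ mxx mY) (split3 _ _ mxx mxy).
have -> : (\int[PP]_(zz in ~` S) (sqdist zz.1.1 (Y zz))%:E =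
           \int[PP]_(zz in ~` S) (sqdist zz.1.1 zz.1.2)%:E)%E.
  by apply: eq_integral => zz; rewrite inE /= => Hs; rewrite /Y (negbTE (introN idP Hs)).
have -> : (\int[PP]_(zz in S) (sqdist zz.1.1 (Y zz))%:E =
           \int[PP]_(zz in S) (sqdist zz.1.1 zz.2.2)%:E)%E.
  by apply: eq_integral => zz; rewrite inE /= => Hs; rewrite /Y Hs.
have : (\int[PP]_zz (sqdist zz.1.1 zz.1.2)%:E < +oo)%E by rewrite -WE.
rewrite (split3 _ _ mxx mxy).
have swa := swS _ (mm _ _ setT mxx mx'y) (fun _ => sqdist_ge0 _ _).
have swb := swS _ (mm _ _ setT mxx mxy) (fun _ => sqdist_ge0 _ _).
set e := (\int[PP]_(zz in ~` S) _)%E.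
set b := (\int[PP]_(zz in S) (sqdist zz.1.1 zz.1.2)%:E)%E in swb *.
set a := (\int[PP]_(zz in S) (sqdist zz.1.1 zz.2.2)%:E)%E in swa *.
have a0 : (0 <= a)%E by apply: integral_ge0 => zz _; rewrite lee_fin sqdist_ge0.
have b0 : (0 <= b)%E by apply: integral_ge0 => zz _; rewrite lee_fin sqdist_ge0.
have e0 : (0 <= e)%E by apply: integral_ge0 => zz _; rewrite lee_fin sqdist_ge0.
move=> beoo beae.
have boo : (b < +oo)%E by apply: le_lt_trans beoo; rewrite leeDl.
have eoo : (e < +oo)%E by apply: le_lt_trans beoo; rewrite leeDr.
(* The costs off [S] coincide and are finite, so optimality leaves [b <= a] on [S]. *)
have ba : (b <= a)%E.
  by move: beae; rewrite leeD2rE// ge0_fin_numE.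
pose w (zz : T4) : \bar R := (- 2 * cross zz)%:E.
have mw : measurable_fun S w.
  apply: (@measurable_funS _ _ _ _ setT) => //; apply/measurable_EFinP.
  by apply: measurable_funM => //; exact: measurable_cross.
have w0 zz : S zz -> (0 <= w zz)%E by rewrite /w lee_fin mulNr oppr_ge0 => /ltW ?; rewrite mulr_ge0_le0.
(* By swap symmetry [a] and [b] are also the integrals with the samples exchanged, and [sqdist_swap]
   relates the sums over both samples. With [b <= a] the nonnegative [w] must then integrate to
   zero. *)
have key : (a + a + \int[PP]_(zz in S) w zz = b + b)%E.
  rewrite {2}swa {2}swb /=.
  rewrite -!ge0_integralD//; try (by move=> zz _; rewrite lee_fin sqdist_ge0);
    try exact: mm; last 2 first.
  - by move=> zz _; rewrite adde_ge0// lee_fin sqdist_ge0.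
  - by apply: emeasurable_funD; exact: mm.
  apply: eq_integral => zz _; rewrite /w -!EFinD; congr EFin.
  by rewrite sqdist_swap mulNr -addrA subrr addr0.
have Iw0 : (0 <= \int[PP]_(zz in S) w zz)%E by exact: integral_ge0.
have Iw : (\int[PP]_(zz in S) w zz = 0)%E.
  have bfin : b \is a fin_num by rewrite ge0_fin_numE.
  have aoo : (a < +oo)%E.
    apply: (@le_lt_trans _ _ (b + b)%E); last by rewrite lte_add_pinfty.
    by rewrite -key -addeA leeDl// adde_ge0.
  have afin : a \is a fin_num by rewrite ge0_fin_numE.
  apply/eqP; rewrite eq_le Iw0 andbT.
  have : (a + a + \int[PP]_(zz in S) w zz <= a + a + 0)%E.
    by rewrite key adde0 leeD.
  by rewrite leeD2lE// fin_numD afin.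
have [N [mN N0 sN]] : ae_eq PP S w (cst 0%E).
  apply/(ae_eq_integral_abs _ mS mw); rewrite -[RHS]Iw; apply: eq_integral => zz.
  by rewrite inE => /w0 ?; rewrite gee0_abs.
apply/eqP; rewrite eq_le measure_ge0 andbT.
rewrite -[leRHS]N0; apply: le_measure; rewrite ?inE// => zz Sz; apply: sN => /= H.
have [/eqP] := H Sz; rewrite mulf_eq0 oppr_eq0 pnatr_eq0/= => /eqP c0.
by move: Sz; rewrite /S /= c0 ltxx.
Qed.

End optimal_monotone.

Section probability_average.
Context (R : realType) d (Om : measurableType d) (g1 g2 : probability Om R).

(** The average of two optimal couplings is optimal and charges every set that either of them
    charges, so one support serves both. *)
Lemma probability_average : exists g : probability Om R,
  (forall A, g A = (2^-1)%:E * (g1 A + g2 A))%E /\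
  (forall f : Om -> \bar R, measurable_fun setT f -> (forall x, 0 <= f x)%E ->
    \int[g]_x f x = (2^-1)%:E * (\int[g1]_x f x + \int[g2]_x f x))%E.
Proof.
have h0 : 0 <= 2^-1 :> R by rewrite invr_ge0.
pose m : {measure set Om -> \bar R} := mscale (NngNum h0) (measure_add g1 g2).
have mE A : m A = ((2^-1)%:E * (g1 A + g2 A))%E.
  by rewrite -[LHS]/((2^-1)%:E * measure_add g1 g2 A)%E measure_addE.
have m1 : m setT = 1%E.
  rewrite mE !probability_setT -EFinD -EFinM; congr EFin.
  by rewrite -[1 + 1]/(2%:R : R) mulVf.
exists (unit_mass m1); split => // f mf f0.
rewrite -[LHS]/(\int[m]_x f x)%E /m ge0_integral_mscale//.
by rewrite ge0_integral_measure_add.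
Qed.

End probability_average.

(** * The closed support of an optimal coupling is monotone *)

Section closed_support.
Context (R : realType) (d : nat).
Local Notation X := 'rV[R]_d.
Local Notation T := (Rd R d).
Implicit Types g : probability (T * T)%type R.
Implicit Types ab cd : 'rV[rat]_d * 'rV[rat]_d.

Lemma open_ratbox2 ab cd : open (@ratbox R d ab `*` @ratbox R d cd).
Proof.
rewrite openE => -[x y] [/= xa yb]; exists (@ratbox R d ab, @ratbox R d cd) => //=.
by split; apply: open_nbhs_nbhs; split => //; exact: open_ratbox.
Qed.

Lemma measurable_ratbox2 ab cd :
  measurable (@ratbox R d ab `*` @ratbox R d cd : set (T * T)).
Proof.
by apply: measurableX; apply: open_measurable_Rd; exact: open_ratbox.
Qed.

(** As products of rational boxes form a base, this is the largest open null set; its complement is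
    the support of [g]. *)
Definition null_boxes (g : probability (T * T)%type R) : set (X * X) :=
  \bigcup_(ab in [set ab | g (@ratbox R d ab.1 `*` @ratbox R d ab.2) = 0%E])
    (@ratbox R d ab.1 `*` @ratbox R d ab.2).

Lemma open_null_boxes g : open (null_boxes g).
Proof. by apply: bigcup_open => ab _; exact: open_ratbox2. Qed.

Lemma null_boxes_null g : measurable (null_boxes g : set (T * T)) /\
  g (null_boxes g) = 0%E.
Proof.
pose F (k : nat) : set (T * T) := if unpickle k is Some ab then
  if g (@ratbox R d ab.1 `*` @ratbox R d ab.2) == 0%E then @ratbox R d ab.1 `*` @ratbox R d ab.2
  else set0 else set0.
have E : null_boxes g = \bigcup_k F k.
  apply/seteqP; split => [z [ab /= ab0 zab]|z [k _]].
    exists (pickle ab); first exact: I.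
    rewrite /F pickleK (introT eqP ab0); exact: zab.
  by rewrite /F; case: (unpickle k) => // ab; case: eqP => // ab0 zab; exists ab.
have mF k : measurable (F k).
  rewrite /F; case: (unpickle k) => // ab; case: ifP => // _.
  exact: measurable_ratbox2.
have mN : measurable (\bigcup_k F k) by exact: bigcupT_measurable.
rewrite E; split => //; apply/(negligibleP _ mN); apply: negligible_bigcup => k.
apply/(negligibleP _ (mF k)); rewrite /F; case: (unpickle k) => [ab|].
  by case: eqP => // _; exact: measure0.
exact: measure0.
Qed.

Let continuous_coord4 (f : (X * X) * (X * X) -> X) i : continuous f ->
  continuous (fun w => f w ord0 i).
Proof.
move=> cf w; apply: (@continuous_comp _ _ _ f (fun x : X => x ord0 i)); first exact: cf.
exact: coord_continuous.
Qed.

Lemma continuous_cross : continuous (fun w : (X * X) * (X * X) => cross w).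
Proof.
have cf : continuous (fun w : (X * X) * (X * X) => w.1).
  by move=> w; exact: cvg_fst.
have cs : continuous (fun w : (X * X) * (X * X) => w.2).
  by move=> w; exact: cvg_snd.
have cff (f : (X * X) * (X * X) -> X * X) : continuous f -> continuous (fun w => (f w).1).
  move=> ff w; apply: (@continuous_comp _ _ _ f fst); [exact: ff|exact: cvg_fst].
have css (f : (X * X) * (X * X) -> X * X) : continuous f -> continuous (fun w => (f w).2).
  move=> ff w; apply: (@continuous_comp _ _ _ f snd); [exact: ff|exact: cvg_snd].
move=> w; rewrite /cross /inner.
apply: cvg_big; first exact: add_continuous.
move=> i _; rewrite !mxE.
rewrite [X in X @ _ --> _](_ : _ =
  (fun w : (X * X) * (X * X) => w.1.1 ord0 i - w.2.1 ord0 i) \*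
  (fun w : (X * X) * (X * X) => w.1.2 ord0 i - w.2.2 ord0 i)); last by apply/funext => z; rewrite !mxE.
have c11 := @continuous_coord4 (fun w => w.1.1) i (cff _ cf) w.
have c21 := @continuous_coord4 (fun w => w.2.1) i (cff _ cs) w.
have c12 := @continuous_coord4 (fun w => w.1.2) i (css _ cf) w.
have c22 := @continuous_coord4 (fun w => w.2.2) i (css _ cs) w.
exact: cvgM (cvgB c11 c21) (cvgB c12 c22).
Qed.

(** Were [cross] negative at two support points, it would stay negative on a product of boxes around
    them. That product is null, hence so is one of the boxes, although it contains a support
    point. *)
Lemma cross_off_null_boxes g z z' :
  (g \x g)%E [set zz | cross zz < 0] = 0%E ->
  ~ null_boxes g z -> ~ null_boxes g z' -> 0 <= cross (z, z').
Proof.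
move=> S0 zN z'N; rewrite leNgt; apply/negP => c0.
have : nbhs ((z, z') : (X * X) * (X * X)) [set w | cross w < 0].
  exact: (@continuous_cross (z, z') [set r | r < 0] (lt_nbhsl c0)).
case=> -[U V] /= [[[U1 U2] /= [zU1 zU2] sU] [[V1 V2] /= [zV1 zV2] sV]] sUV.
have [a1 [za1 sa1]] := nbhs_ratbox zU1; have [a2 [za2 sa2]] := nbhs_ratbox zU2.
have [b1 [zb1 sb1]] := nbhs_ratbox zV1; have [b2 [zb2 sb2]] := nbhs_ratbox zV2.
set A : set (T * T) := @ratbox R d a1 `*` @ratbox R d a2.
set B : set (T * T) := @ratbox R d b1 `*` @ratbox R d b2.
have mA : measurable A by exact: measurable_ratbox2.
have mB : measurable B by exact: measurable_ratbox2.
have : (g A * g B = 0)%E.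
  apply/eqP; rewrite eq_le mule_ge0// andbT.
  rewrite -[leRHS]S0.
  rewrite -[leLHS](@product_measure1E _ _ _ _ _ g g)//.
  apply: le_measure; rewrite ?inE.
  - exact: measurableX.
  - have := measurable_fun_ltr (@measurable_cross R d) (@measurable_cst _ _ _ _ setT (0 : R)).
    by move=> /(_ measurableT [set true]); rewrite setTI; apply.
  - move=> [w w'] [[Aw1 Aw2] [Bw1 Bw2]]; apply: sUV; split => /=.
      by apply: sU; split; [exact: sa1|exact: sa2].
    by apply: sV; split; [exact: sb1|exact: sb2].
move=> /eqP; rewrite mule_eq0 => /orP[/eqP A0|/eqP B0].
  by apply: zN; exists (a1, a2).
by apply: z'N; exists (b1, b2).
Qed.

End closed_support.

(** * Closed monotone sets are graphs off small sets *)

Section closed_monotone_set.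
Context (R : realType) (n : nat).
Local Notation X := 'rV[R]_n.+1.
Local Notation T := (Rd R n.+1).

Lemma closed_preimage_continuous (U V : topologicalType) (f : U -> V) (C : set V) :
  continuous f -> closed C -> closed (f @^-1` C).
Proof.
move=> cf cC; rewrite -openC preimage_setC; apply: open_comp.
  by move=> x _; exact: cf.
by rewrite openC.
Qed.

Definition cube (M : R) : set X := [set v | forall i, `|v ord0 i| <= M].

Lemma compact_cube M : compact (cube M).
Proof.
rewrite (_ : cube M = [set v : X | forall i, `[- M, M]%classic (v ord0 i)]).
  by apply: (@rV_compact R _ (fun=> `[- M, M]%classic)) => i; exact: segment_compact.
apply/seteqP; split => v H i; have := H i; rewrite /= in_itv/= ler_norml//.
Qed.

Lemma cubeS (M M' : R) : M <= M' -> cube M `<=` cube M'.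
Proof. by move=> MM v vM i; apply: le_trans MM; exact: vM. Qed.

Lemma cube_nat (v : X) : exists k : nat, cube k%:R v.
Proof.
exists (Num.truncn (\sum_i `|v ord0 i|)).+1 => i.
apply: le_trans (ltW (truncnS_gt _)).
by rewrite (bigD1 i)//= lerDl sumr_ge0.
Qed.

Variable Gam : set (X * X).
Hypothesis closed_Gam : closed Gam.

Definition slice (C : set X) : set X := [set x | exists2 y, C y & Gam (x, y)].

(** The projection of a closed set need not be closed; exhausting by cubes writes the slice as a
    countable union of compact, hence closed, projections. *)
Lemma measurable_slice C : closed C -> measurable (slice C : set T).
Proof.
move=> cC.
have -> : slice C = \bigcup_k
    (fst @` ((cube k%:R `*` cube k%:R) `&` (Gam `&` snd @^-1` C))).
  apply/seteqP; split => [x [y Cy Gxy]|x [k _ [[x' y] [_ [Gxy Cy]] /= <-]]]; last by exists y.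
  have [kx xk] := cube_nat x; have [ky yk] := cube_nat y.
  exists (maxn kx ky) => //; exists (x, y) => //; split => //; split => /=.
    by apply: cubeS xk; rewrite ler_nat leq_maxl.
  by apply: cubeS yk; rewrite ler_nat leq_maxr.
apply: bigcupT_measurable => k; apply: closed_measurable_Rd.
apply: compact_closed; first exact: norm_hausdorff.
apply: continuous_compact.
  by apply: continuous_subspaceT => x; exact: cvg_fst.
apply: compact_closedI; first by apply: compact_setX; exact: compact_cube.
apply: closedI => //; apply: closed_preimage_continuous => //.
by move=> x; exact: cvg_snd.
Qed.

(** Keeping the point and both of its values in a cube makes the set compact; the gap from [p] to
    [q] between the values makes the Lipschitz constant uniform. *)
Definition multi (i : 'I_n.+1) (p q M : R) : set X :=
  fst @` ((cube M `*` (cube M `*` cube M)) `&`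
    [set w : X * (X * X) | [/\ Gam (w.1, w.2.1), Gam (w.1, w.2.2),
       w.2.1 ord0 i <= p & q <= w.2.2 ord0 i]]).

Lemma compact_multi i p q M : compact (multi i p q M).
Proof.
apply: continuous_compact.
  by apply: continuous_subspaceT => x; exact: cvg_fst.
apply: compact_closedI.
  by apply: compact_setX; [|apply: compact_setX]; exact: compact_cube.
have c1 : continuous (fun w : X * (X * X) => w.1) by move=> w; exact: cvg_fst.
have c2 : continuous (fun w : X * (X * X) => w.2) by move=> w; exact: cvg_snd.
have c21 : continuous (fun w : X * (X * X) => w.2.1).
  by move=> w; apply: (@continuous_comp _ _ _ snd fst); [exact: c2|exact: cvg_fst].
have c22 : continuous (fun w : X * (X * X) => w.2.2).
  by move=> w; apply: (@continuous_comp _ _ _ snd snd); [exact: c2|exact: cvg_snd].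
have ci (f : X * (X * X) -> X) : continuous f -> continuous (fun w => f w ord0 i).
  move=> cf w; apply: (@continuous_comp _ _ _ f (fun x : X => x ord0 i)); first exact: cf.
  exact: coord_continuous.
rewrite (_ : mkset _ =
  (fun w : X * (X * X) => (w.1, w.2.1)) @^-1` Gam `&`
  (fun w : X * (X * X) => (w.1, w.2.2)) @^-1` Gam `&`
  (fun w : X * (X * X) => w.2.1 ord0 i) @^-1` [set r | r <= p] `&`
  (fun w : X * (X * X) => w.2.2 ord0 i) @^-1` [set r | q <= r]); last first.
  by apply/seteqP; split => w /= [] // [[]].
apply: closedI; first apply: closedI; first apply: closedI.
- apply: closed_preimage_continuous => // w.
  exact: (cvg_pair (c1 w) (c21 w)).
- apply: closed_preimage_continuous => // w.
  exact: (cvg_pair (c1 w) (c22 w)).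
- exact: closed_preimage_continuous (ci _ c21) (@closed_le R p).
- exact: closed_preimage_continuous (ci _ c22) (@closed_ge R q).
Qed.

Hypothesis monotone_Gam : forall x y x' y' : X, Gam (x, y) -> Gam (x', y') ->
  0 <= inner (x - x') (y - y').

(** Monotonicity plays the term of coordinate [i], where the values differ by at least [e], against
    the remaining terms, where they differ by at most [2 * M]. *)
Let monotone_gap i (e M : R) (x y x' y' : X) : 0 < e -> Gam (x, y) -> Gam (x', y') ->
  cube M y -> cube M y' -> e <= y ord0 i - y' ord0 i ->
  (x' ord0 i - x ord0 i) * e <=
  2 * M * \sum_(j < n) `|x ord0 (lift i j) - x' ord0 (lift i j)|.
Proof.
move=> e0 Gx Gx' My My' ey; have := monotone_Gam Gx Gx'.
rewrite /inner (bigD1_ord i)//= !mxE.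
set s := \sum_(j < n) _; set r := \sum_(j < n) `|_| => h.
have M0 : 0 <= M by apply: le_trans (My i).
have sr : s <= 2 * M * r.
  rewrite /s /r mulr_sumr; apply: ler_sum => j _; rewrite !mxE.
  apply: le_trans (ler_norm _) _; rewrite normrM mulrC.
  apply: ler_wpM2r => //; apply: le_trans (ler_normB _ _) _.
  by rewrite mulr_natl mulr2n lerD.
have r0 : 0 <= 2 * M * r by rewrite !mulr_ge0// sumr_ge0.
have [xx|xx] := lerP (x' ord0 i - x ord0 i) 0.
  by apply: le_trans r0; rewrite mulr_le0_ge0// ltW.
apply: le_trans sr.
have := ler_wpM2l (ltW xx) ey; lra.
Qed.

(** Monotonicity is applied crosswise: the upper value at one point against the lower value at the
    other, in both orders for the two signs. *)
Lemma multi_lipschitz i p q M x x' : p < q -> multi i p q M x -> multi i p q M x' ->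
  `|x ord0 i - x' ord0 i| <=
  2 * M / (q - p) * \sum_(j < n) `|x ord0 (lift i j) - x' ord0 (lift i j)|.
Proof.
move=> pq [[u [y1 y2]] [[_ [My1 My2]] [/= G1 G2 y1p y2q]] /= <-].
move=> [[v [y1' y2']] [[_ [My1' My2']] [/= G1' G2' y1p' y2q']] /= <-].
have e0 : 0 < q - p by rewrite subr_gt0.
have h1 := monotone_gap (i := i) e0 G2 G1' My2 My1' (lerB y2q y1p').
have h2 := monotone_gap (i := i) e0 G2' G1 My2' My1 (lerB y2q' y1p).
rewrite mulrAC ler_pdivlMr//; have [xx|xx] := lerP 0 (u ord0 i - v ord0 i).
  rewrite ger0_norm//; apply: (le_trans h2); apply: ler_wpM2l.
    by rewrite mulr_ge0//; apply: le_trans (My1 i).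
  by apply: ler_sum => j _; rewrite distrC.
by rewrite ltr0_norm// opprB.
Qed.

(* The points where a closed monotone set is multivalued lie on countably many
   Lipschitz graphs, which a measure vanishing on small sets does not see. *)
Definition multivalued : set X :=
  \bigcup_(k : 'I_n.+1 * rat * rat * nat)
    if k.1.1.2 < k.1.2 then multi k.1.1.1 (ratr k.1.1.2) (ratr k.1.2) k.2%:R else set0.

Lemma measurable_multi i p q M : measurable (multi i p q M : set T).
Proof.
apply: closed_measurable_Rd; apply: compact_closed; first exact: norm_hausdorff.
exact: compact_multi.
Qed.

Lemma multivalued_null (mu : probability T R) : no_small_sets mu ->
  measurable (multivalued : set T) /\ mu multivalued = 0%E.
Proof.
move=> mu0.
pose F (k : nat) : set T := if (unpickle k : option ('I_n.+1 * rat * rat * nat)) is Some (i, p, q, M) then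
  if p < q then multi i (ratr p) (ratr q) M%:R else set0 else set0.
have E : multivalued = \bigcup_k F k.
  apply/seteqP; split => [x [[[[i p] q] M] _ xk]|x [k _]].
    by exists (pickle (i, p, q, M)); [exact: I|rewrite /F pickleK; exact: xk].
  by rewrite /F; case: (unpickle k) => // -[[[i p] q] M] xk; exists (i, p, q, M).
have mF k : measurable (F k).
  rewrite /F; case: (unpickle k) => // -[[[i p] q] M]; case: ifP => // _.
  exact: measurable_multi.
have mN : measurable (\bigcup_k F k) by exact: bigcupT_measurable.
rewrite E; split => //; apply/(negligibleP _ mN); apply: negligible_bigcup => k.
apply/(negligibleP _ (mF k)).
have := mF k; rewrite /F; case: (unpickle k) => [[[[i p] q] M]|]; last by rewrite measure0.
case: ifP => [pq mm|_]; last by rewrite measure0.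
apply: mu0 => //=.
have pq' : ratr p < ratr q :> R by rewrite ltr_rat.
apply: (@hausdorff_lipschitz_graph R n _ i (2 * M%:R / (ratr q - ratr p)) M%:R) => //.
- by rewrite divr_ge0// ?mulr_ge0// subr_ge0 ltW.
- by move=> x j [w [[Mx _] _] <-]; exact: Mx.
- by move=> x y; exact: multi_lipschitz.
Qed.

(** If two values differ in coordinate [i], two rationals fit strictly between them and some integer
    cube contains everything, so [x] lies in one of the [multi] sets. *)
Lemma not_multivalued (x y y' : X) : ~ multivalued x -> Gam (x, y) -> Gam (x, y') -> y = y'.
Proof.
have wlog_lt (u v : X) i : ~ multivalued x -> Gam (x, u) -> Gam (x, v) ->
    u ord0 i < v ord0 i -> False.
  move=> xN Gu Gv uv; apply: xN.
  have [p] := rat_in_itvoo uv; rewrite in_itv/= => /andP[up pv].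
  have [q] := rat_in_itvoo pv; rewrite in_itv/= => /andP[pq qv].
  have [kx xk] := cube_nat x; have [ku uk] := cube_nat u; have [kv vk] := cube_nat v.
  exists (i, p, q, maxn kx (maxn ku kv)) => //=; rewrite -(ltr_rat R) pq.
  exists (x, (u, v)) => //=; split; last by split => //=; exact: ltW.
  split; last split => /=.
  - by apply: cubeS xk; rewrite ler_nat leq_max leqnn.
  - by apply: cubeS uk; rewrite ler_nat !leq_max leqnn orbT.
  - by apply: cubeS vk; rewrite ler_nat !leq_max leqnn !orbT.
move=> xN Gy Gy'; apply/rowP => i.
have [yy|yy|//] := ltgtP (y ord0 i) (y' ord0 i); first by have := wlog_lt y y' i xN Gy Gy' yy.
by have := wlog_lt y' y i xN Gy' Gy yy.
Qed.

Lemma closed_monotone_map (mu : probability T R) : no_small_sets mu ->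
  exists t : T -> T, measurable_fun setT t /\
    exists N : set T, [/\ measurable N, mu N = 0%E &
      forall x y : X, Gam (x, y) -> ~ N x -> y = t x].
Proof.
move=> mu0; have [mN N0] := multivalued_null mu0.
(* The value 0 is a default at multivalued points; [xget] also returns 0 where [Gam] has no point
   above [x]. *)
pose t (x : X) : X := if `[< multivalued x >] then 0 else xget 0 [set y | Gam (x, y)].
have tE x y : Gam (x, y) -> ~ multivalued x -> y = t x.
  move=> Gxy xN; rewrite /t; case: asboolP => // _.
  by apply: (not_multivalued xN Gxy); exact: (@xgetPex _ 0 [set y | Gam (x, y)] (ex_intro _ y Gxy)).
exists t; split; last by exists multivalued; split.
apply: (@measurability _ _ T T setT t (@open X) erefl) => _ [U oU <-].
rewrite setTI -(setCK U) -preimage_setC; apply: measurableC.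
have cC : closed (~` U) by rewrite closedC.
move: (~` U) cC => C cC {U oU}.
(* [Z] collects the points where the default is used; off [Z] the preimage of a closed set is a
   slice. *)
pose Z : set T := multivalued `|` ~` slice setT.
have mZ : measurable Z.
  apply: measurableU => //; apply: measurableC; apply: measurable_slice.
  exact: closedT.
have tZ x : Z x -> t x = 0.
  rewrite /t; case: asboolP => // xN [//|xs]; rewrite xgetPN// => y Gxy.
  by apply: xs; exists y.
have -> : t @^-1` C = (slice C `\` Z) `|` (if `[< C 0 >] then Z else set0).
  apply/seteqP; split => x.
    rewrite /preimage /= => Ctx; have [Zx|Zx] := pselect (Z x).
      by right; rewrite tZ// in Ctx; case: asboolP.
    left; split => //; have xN : ~ multivalued x by move=> ?; apply: Zx; left.
    have [y _ Gxy] : slice setT x by apply: contrapT => ?; apply: Zx; right.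
    by exists y; rewrite // (tE _ _ Gxy xN).
  case=> [[[y Cy Gxy] Zx]|]; last by case: asboolP => // C0 /tZ; rewrite /preimage /= => ->.
  by rewrite /preimage /= -(tE _ _ Gxy)// => ?; apply: Zx; left.
apply: measurableU; last by case: asboolP.
by apply: measurableD => //; exact: measurable_slice.
Qed.

End closed_monotone_set.

Lemma half_addee (R : realType) (a : \bar R) : ((2^-1)%:E * (a + a) = a)%E.
Proof.
case: a => [a||].
- by rewrite -EFinD -EFinM; congr EFin; field.
- by rewrite addye// gt0_muley// lte_fin invr_gt0.
- by rewrite addNye gt0_muleNy// lte_fin invr_gt0.
Qed.

(** * Brenier's theorem: existence and uniqueness of the optimal map *)

Section brenier.
Context (R : realType) (n : nat).
Local Notation T := (Rd R n.+1).

(** The average [g] is optimal, so its support is monotone and, off a null set, a graph. Sets null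
    for [g] are null for [g1] and [g2], which therefore share the map. One coupling taken twice
    gives existence of a map, two couplings give uniqueness. *)
Lemma optimal_coupling_map (mu nu : probability T R) (g1 g2 : probability (T * T)%type R) :
  no_small_sets mu -> (W2sq mu nu < +oo)%E ->
  opt_coupling mu nu g1 -> opt_coupling mu nu g2 ->
  exists t : T -> T, [/\ measurable_fun setT t,
    {ae g1, forall z, z.2 = t z.1} & {ae g2, forall z, z.2 = t z.1}].
Proof.
move=> mu0 Woo [[g11 g12] g1E] [[g21 g22] g2E].
have [g [gE gI]] := probability_average g1 g2.
have go : opt_coupling mu nu g.
  split; first by split => A mA; rewrite gE ?(g11 A mA) ?(g21 A mA) ?(g12 A mA) ?(g22 A mA) half_addee.
  rewrite /cost gI -?/(cost g1) -?/(cost g2) ?g1E ?g2E ?half_addee//.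
    exact: measurable_sqdistE measurable_fst measurable_snd.
  by move=> z; rewrite lee_fin sqdist_ge0.
have S0 := optimal_cross_null go Woo.
have [mB B0] := null_boxes_null g.
have closedG : closed (~` null_boxes g) by rewrite closedC; exact: open_null_boxes.
have monG (x y x' y' : 'rV[R]_n.+1) : (~` null_boxes g) (x, y) -> (~` null_boxes g) (x', y') ->
    0 <= inner (x - x') (y - y').
  by move=> Gz Gz'; exact: (cross_off_null_boxes S0 Gz Gz').
have [t [mt [N [mN N0 tN]]]] := closed_monotone_map closedG monG mu0.
have [B1 B2] : g1 (null_boxes g) = 0%E /\ g2 (null_boxes g) = 0%E.
  have /eqP := B0; rewrite gE mule_eq0 eqe invr_eq0 pnatr_eq0/=.
  by rewrite padde_eq0// => /andP[/eqP-> /eqP->].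
have ae (h : probability (T * T)%type R) : pushes h fst mu -> h (null_boxes g) = 0%E ->
    {ae h, forall z, z.2 = t z.1}.
  move=> h1 hB; exists (null_boxes g `|` fst @^-1` N); split.
  - apply: measurableU => //; rewrite -[X in measurable X]setTI.
    exact: measurable_fst.
  - rewrite -[RHS]hB; apply: measureU0 => //.
      by rewrite -[X in measurable X]setTI; exact: measurable_fst.
    by rewrite -[RHS]N0; exact: h1.
  - move=> z /= zt; apply: contrapT => /not_orP[zB zN]; apply: zt.
    by apply: tN => //; case: z zB {zN}.
by exists t; split => //; exact: ae.
Qed.

End brenier.

(** * Transport plans induced by maps *)

Section almost_everywhere_maps.
Context (R : realType) d1 d2 (T1 : measurableType d1) (T2 : measurableType d2).
Implicit Types (P : probability T1 R) (Q : probability T2 R) (f g : T1 -> T2).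

Lemma pushes_ae_eq P f g Q : measurable_fun setT f -> measurable_fun setT g ->
  {ae P, forall x, f x = g x} -> pushes P f Q -> pushes P g Q.
Proof.
move=> mf mg [N [mN N0 sN]] fQ A mA; rewrite -(fQ A mA).
have le (h k : T1 -> T2) : measurable_fun setT h -> measurable_fun setT k ->
    (forall x, ~ N x -> h x = k x) -> (P (h @^-1` A) <= P (k @^-1` A))%E.
  move=> mh mk hk.
  have mhA : measurable (h @^-1` A) by rewrite -[X in measurable X]setTI; exact: mh.
  have mkA : measurable (k @^-1` A) by rewrite -[X in measurable X]setTI; exact: mk.
  rewrite -(measureU0 mkA mN N0).
  apply: le_measure; rewrite ?inE//; first exact: measurableU.
  move=> x hA; have [?|xN] := pselect (N x); [by right|left].
  by rewrite /preimage /= -hk.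
have E x : ~ N x -> f x = g x.
  by move=> xN; apply: contrapT => fg; apply: xN; exact: sN.
by apply/eqP; rewrite eq_le !le// => x /E.
Qed.

End almost_everywhere_maps.

Section plans.
Context (R : realType) (d : nat).
Local Notation T := (Rd R d).
Implicit Types mu nu om : probability T R.

Lemma integral_sqdist_ae d' (Om : measurableType d') (P : probability Om R)
    (X Y X' Y' : Om -> T) :
  measurable_fun setT X -> measurable_fun setT Y ->
  measurable_fun setT X' -> measurable_fun setT Y' ->
  {ae P, forall w, X w = X' w} -> {ae P, forall w, Y w = Y' w} ->
  (\int[P]_w (sqdist (X w) (Y w))%:E = \int[P]_w (sqdist (X' w) (Y' w))%:E)%E.
Proof.
move=> mX mY mX' mY' XX YY; apply: ae_eq_integral => //.
- exact: measurable_sqdistE.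
- exact: measurable_sqdistE.
- by apply: filterS2 XX YY => w -> -> _.
Qed.

Lemma integral_sqdist_pushes d' (Om : measurableType d') (P : probability Om R)
    (Y : Om -> T) nu (f g : T -> T) :
  pushes P Y nu -> measurable_fun setT Y ->
  measurable_fun setT f -> measurable_fun setT g ->
  (\int[nu]_x (sqdist (f x) (g x))%:E = \int[P]_w (sqdist (f (Y w)) (g (Y w)))%:E)%E.
Proof.
move=> PY mY mf mg; rewrite (ge0_integral_pushes PY)//.
  exact: measurable_sqdistE.
by move=> x; rewrite lee_fin sqdist_ge0.
Qed.

Local Notation T3 := (T * T * T)%type.

Definition interp_map (a : R) (s : T -> T) (x : T) : T :=
  (1 - a) *: (x : 'rV[R]_d) + a *: (s x : 'rV[R]_d).

Lemma measurable_interp_map a s : measurable_fun setT s ->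
  measurable_fun setT (interp_map a s).
Proof. by move=> ms; apply: measurable_rVD; apply: measurable_rVZ. Qed.

Lemma measurable_x1 : measurable_fun setT (fun z : T3 => z.1.1).
Proof. exact: measurableT_comp measurable_fst measurable_fst. Qed.

Lemma measurable_x2 : measurable_fun setT (fun z : T3 => z.1.2).
Proof. exact: measurableT_comp measurable_snd measurable_fst. Qed.

Lemma measurable_x3 : measurable_fun setT (fun z : T3 => z.2).
Proof. exact: measurable_snd. Qed.

Lemma measurable_interp a : measurable_fun setT (@interp R d a).
Proof.
by apply: measurable_rVD; apply: measurable_rVZ; [exact: measurable_x2|exact: measurable_x3].
Qed.

Lemma pushes_coupling d' (Om : measurableType d') (P : probability Om R)
    (X Y : Om -> T) mu nu p :
  measurable_fun setT X -> measurable_fun setT Y ->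
  pushes P (fun w => (X w, Y w)) p -> opt_coupling mu nu p ->
  [/\ pushes P X mu, pushes P Y nu &
    (\int[P]_w (sqdist (X w) (Y w))%:E)%E = W2sq mu nu].
Proof.
move=> mX mY Pp [[p1 p2] pE]; split.
- move=> A mA; rewrite -p1// -Pp//.
  by rewrite -[X in measurable X]setTI; exact: measurable_fst.
- move=> A mA; rewrite -p2// -Pp//.
  by rewrite -[X in measurable X]setTI; exact: measurable_snd.
- rewrite -pE /cost (ge0_integral_pushes Pp)//.
  + exact: measurable_fun_pair.
  + exact: measurable_sqdistE measurable_fst measurable_snd.
  + by move=> x; rewrite lee_fin sqdist_ge0.
Qed.

(** Moving [nu] by [f] inside a finite-cost coupling with [omega0] adds only the displacement of
    [f], by the triangle inequality. *)
Lemma P2_pushes omega0 nu nu' f : P2 omega0 nu -> measurable_fun setT f ->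
  pushes nu f nu' -> (\int[nu]_x (sqdist x (f x))%:E < +oo)%E -> P2 omega0 nu'.
Proof.
move=> nuP mf fnu' foo; move: nuP; rewrite /P2 {1}/W2sq => /ereal_inf_lt[_ [p [p1 p2] <-] poo].
have mfz : measurable_fun setT (fun z : T * T => f z.1).
  exact: measurableT_comp mf measurable_fst.
have pf : pushes p (fun z => f z.1) nu'.
  move=> A mA; rewrite -fnu'// -p1//.
  by rewrite -[X in measurable X]setTI; exact: mf.
apply: (le_lt_trans (W2sq_le mfz measurable_snd pf p2)).
apply: (integral_sqdist_triangle mfz measurable_fst measurable_snd _ poo).
rewrite -(integral_sqdist_pushes p1 measurable_fst mf (@measurable_id _ _ _)).
by under eq_integral do rewrite sqdistC.
Qed.

(** Once the third coordinate is a function of the second, the generalized geodesic is read on [nu]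
    alone, as push-forwards by [interp_map a s]. *)
Lemma plan_of_map om nu nu' (W : probability T3 R) (s : T -> T) :
  measurable_fun setT s -> transport_plan om nu nu' W ->
  {ae W, forall z : T3, z.2 = s z.1.2} ->
  [/\ W2plan_sq W = (\int[nu]_x (sqdist x (s x))%:E)%E, pushes nu s nu' &
    forall a, exists mua, pushes W (interp a) mua /\
      pushes nu (interp_map a s) mua].
Proof.
move=> ms [[p [Wp po]] [q [Wq qo]]] Ws.
have [W1 W2 _] := pushes_coupling measurable_x1 measurable_x2 Wp po.
have [_ W3 _] := pushes_coupling measurable_x1 measurable_x3 Wq qo.
have msz : measurable_fun setT (fun z : T3 => s z.1.2).
  exact: measurableT_comp ms measurable_x2.
have pre (f : T -> T) Q : measurable_fun setT f ->
    pushes W (fun z => f z.1.2) Q -> pushes nu f Q.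
  move=> mf WQ A mA; rewrite -WQ// -W2//.
  by rewrite -[X in measurable X]setTI; exact: mf.
split.
- rewrite (integral_sqdist_pushes W2 measurable_x2 (@measurable_id _ _ _) ms).
  apply: integral_sqdist_ae => //; [exact: measurable_x2|exact: measurable_x2|].
  by apply: nearW.
- apply: pre => //; exact: pushes_ae_eq measurable_x3 msz Ws W3.
- move=> a; have [mua Wa] := pushes_exists W (measurable_interp a).
  have mta := measurable_interp_map a ms.
  exists mua; split => //; apply: pre => //.
  apply: (pushes_ae_eq (measurable_interp a) _ _ Wa).
    exact: measurableT_comp mta measurable_x2.
  by apply: filterS Ws => z; rewrite /interp /interp_map => ->.
Qed.

End plans.

(** * Letting the step along a geodesic tend to zero *)

Section small_step_limit.
Context (R : realType).

(** [D] does not depend on the step, so [a] may tend to zero with [eps] arbitrary. [b] stands for a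
    squared displacement, [k] for a first-order term. *)
Lemma small_step_limit (D l b k : R) : 0 <= b ->
  (forall eps, 0 < eps -> exists delta, 0 < delta /\ forall a, 0 < a < 1 ->
     a ^+ 2 * b < delta ^+ 2 -> (1 - a) * (l / 2) * b + k - eps * Num.sqrt b <= D) ->
  l / 2 * b + k <= D.
Proof.
move=> b0 H; apply/ler_addgt0Pr => eta eta0.
set r := Num.sqrt b; have r0 : 0 <= r := sqrtr_ge0 b.
have r10 : 0 < 2 * (r + 1) by rewrite mulr_gt0// ltr_wpDl.
(* This [eps] makes [eps * r] at most [eta / 2]; the added 1 guards against [r = 0]. *)
have [delta [delta0 Hd]] := H (eta / (2 * (r + 1))) (divr_gt0 eta0 r10).
have c0 : 0 < `|l| * b + 1 by rewrite ltr_wpDl// mulr_ge0.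
(* The three bounds give in turn [a < 1], a displacement [a * r] below [delta], and a convexity
   error [a * (l / 2) * b] of at most [eta / 2]. *)
pose a := Num.min 2^-1 (Num.min (delta / (2 * (r + 1))) (eta / (`|l| * b + 1))).
have a0 : 0 < a by rewrite !lt_min invr_gt0 ltr0n/= !divr_gt0.
have a1 : a <= 2^-1 by rewrite ge_min lexx.
have a2 : a * (2 * (r + 1)) <= delta.
  by rewrite -ler_pdivlMr// !ge_min lexx !orbT.
have a3 : a * (`|l| * b + 1) <= eta.
  by rewrite -ler_pdivlMr// !ge_min lexx !orbT.
have a01 : 0 < a < 1 by rewrite a0 (le_lt_trans a1)// invf_lt1// ltr1n.
have ab : a ^+ 2 * b < delta ^+ 2.
  have ar : a * r < delta by nra.
  rewrite -(sqr_sqrtr b0) -/r -exprMn ltr_pXn2r// nnegrE ?(ltW delta0)//.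
  by rewrite mulr_ge0// ltW.
have e1 : eta / (2 * (r + 1)) * r <= eta / 2.
  rewrite mulrAC ler_pdivrMr// mulrA divfK//; nra.
have e2 : a * (l / 2) * b <= eta / 2.
  have : a * (l * b) <= a * (`|l| * b).
    by apply: ler_wpM2l; [exact: ltW|apply: ler_wpM2r => //; exact: ler_norm].
  nra.
have := Hd a a01 ab; rewrite -/r.
have -> : (1 - a) * (l / 2) * b = l / 2 * b - a * (l / 2) * b by ring.
move: e1 e2; move: (_ * r) (a * _ * b) (l / 2 * b) => u v w; lra.
Qed.

End small_step_limit.

(** * Proximal steps *)

Section interpolated_integrals.
Context (R : realType) (d : nat).
Local Notation T := (Rd R d).
Variables (nu : probability T R) (t s : T -> T).
Hypotheses (mt : measurable_fun setT t) (ms : measurable_fun setT s).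
Hypothesis too : (\int[nu]_x (sqdist x (t x))%:E < +oo)%E.
Hypothesis soo : (\int[nu]_x (sqdist x (s x))%:E < +oo)%E.
Let A := fine (\int[nu]_x (sqdist x (t x))%:E).
Let B := fine (\int[nu]_x (sqdist x (s x))%:E).
Let C := fine (\int[nu]_x (sqdist (t x) (s x))%:E).

Let mid := @measurable_id _ T setT.

Let too' : (\int[nu]_x (sqdist (t x) x)%:E < +oo)%E.
Proof. by under eq_integral do rewrite sqdistC. Qed.

Lemma integral_sqdist_maps : (\int[nu]_x (sqdist (t x) (s x))%:E)%E = C%:E.
Proof. by rewrite integral_sqdist_fin//; exact: integral_sqdist_triangle too' soo. Qed.

Lemma integral_sqdist_interp_map a :
  (\int[nu]_x (sqdist (t x) (interp_map a s x))%:E)%E =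
  ((1 - a) * A + a * C + - (a * (1 - a)) * B)%:E.
Proof.
have tsoo : (\int[nu]_x (sqdist (t x) (s x))%:E < +oo)%E.
  exact: integral_sqdist_triangle too' soo.
transitivity (\int[nu]_x ((1 - a) * sqdist (t x) x + a * sqdist (t x) (s x)
                          + - (a * (1 - a)) * sqdist x (s x))%:E)%E.
  by apply: eq_integral => x _; rewrite sqdist_interp.
rewrite integral_lin3; [|exact: integrable_sqdist..].
by congr (_ * fine _ + _ + _)%:E; apply: eq_integral => x _; rewrite sqdistC.
Qed.

Lemma integral_sqdist_interp_map_id a :
  (\int[nu]_x (sqdist (interp_map a s x) x)%:E)%E = (a ^+ 2 * B)%:E.
Proof.
transitivity (\int[nu]_x ((a ^+ 2)%:E * (sqdist x (s x))%:E))%E.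
  apply: eq_integral => x _; rewrite -EFinM; congr EFin.
  by rewrite sqdistC sqdist_interp sqdistxx; ring.
by rewrite integralZl//; [rewrite integral_sqdist_fin|exact: integrable_sqdist].
Qed.

Lemma integral_inner_map (k : R) :
  (\int[nu]_x (inner (k *: ((t x : 'rV[R]_d) - x)) ((s x : 'rV[R]_d) - x))%:E)%E =
  (k * (2^-1 * (A + B - C)))%:E.
Proof.
transitivity (\int[nu]_x (k%:E *
    (inner ((t x : 'rV[R]_d) - x) ((s x : 'rV[R]_d) - x))%:E))%E.
  apply: eq_integral => x _; rewrite -EFinM; congr EFin.
  by rewrite -[X in inner _ X]scale1r innerZ mulr1.
rewrite integralZl//; last exact: integrable_inner mt mid ms too' soo.
have tC : (\int[nu]_x (sqdist (t x) x)%:E = \int[nu]_x (sqdist x (t x))%:E)%E.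
  by apply: eq_integral => x _; rewrite sqdistC.
by rewrite (integral_inner mt mid ms too' soo) tC -EFinM.
Qed.

Lemma interp_mapB a x :
  (interp_map a s x : 'rV[R]_d) - x = a *: ((s x : 'rV[R]_d) - x).
Proof. by apply/rowP => i; rewrite /interp_map !mxE; ring. Qed.

End interpolated_integrals.

Section interp_inner.
Context (R : realType) (d : nat).
Local Notation T := (Rd R d).

Lemma integral_inner_interp_map (nu : probability T R) (t s : T -> T) (k a : R) :
  measurable_fun setT t -> measurable_fun setT s ->
  (\int[nu]_x (sqdist x (t x))%:E < +oo)%E ->
  (\int[nu]_x (sqdist x (s x))%:E < +oo)%E ->
  (\int[nu]_x (inner (k *: ((t x : 'rV[R]_d) - x))
                     ((interp_map a s x : 'rV[R]_d) - x))%:E)%E =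
  (k * a * (2^-1 * (fine (\int[nu]_x (sqdist x (t x))%:E)
     + fine (\int[nu]_x (sqdist x (s x))%:E)
     - fine (\int[nu]_x (sqdist (t x) (s x))%:E))))%:E.
Proof.
move=> mt ms too soo; rewrite -(integral_inner_map mt ms too soo).
apply: eq_integral => x _; rewrite interp_mapB; congr EFin.
by rewrite -[X in _ = inner _ X]scale1r !innerZ mulr1.
Qed.

End interp_inner.

Section step_arithmetic.
Context (R : realType).
Implicit Types a e ea l b k r h : R.

(** [h] stands for [tau^-1], [r] for the length of the displacement, [ea] for the energy at
    parameter [a]; the common factor [a] is cancelled afterwards. *)
Lemma strong_step_arith a e e' ea l b k r h eps :
  h * a * k - eps * (a * r) <= ea - e ->
  ea <= (1 - a) * e + a * e' - a * (1 - a) * (l / 2) * b ->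
  a * ((1 - a) * (l / 2) * b + h * k - eps * r) <= a * (e' - e).
Proof. lra. Qed.

(** The term [- (a * (1 - a)) * b] of the squared-distance identity enters with weight [h / 2],
    which turns [l] into [l + h]. *)
Lemma minimizing_step_arith a e e' ea l b h A C :
  A * (2^-1 * h) + e <= ((1 - a) * A + a * C + - (a * (1 - a)) * b) * (2^-1 * h) + ea ->
  ea <= (1 - a) * e + a * e' - a * (1 - a) * (l / 2) * b ->
  a * ((1 - a) * ((l + h) / 2) * b + h * (2^-1 * (A - C))) <= a * (e' - e).
Proof. lra. Qed.

End step_arithmetic.

Section proximal_step.
Context (R : realType) (n : nat).
Local Notation T := (Rd R n.+1).
Variables (omega0 : probability T R) (E : probability T R -> \bar R) (lambda : R).
Hypothesis E_noninf : forall mu, P2 omega0 mu -> E mu != -oo%E.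
Hypothesis H_dom : forall mu, domE omega0 E mu -> no_small_sets mu.
Hypothesis H_conv : gen_geod_convex omega0 E lambda.
Implicit Types mu nu : probability T R.

Lemma P2_base : P2 omega0 omega0.
Proof. by rewrite /P2 W2sqxx ltry. Qed.

(** The plan with base [omega0] glues optimal couplings to [mu] and to [nu], so the pointwise
    triangle inequality can be integrated. *)
Lemma W2sq_P2_lty mu nu : P2 omega0 mu -> P2 omega0 nu -> (W2sq mu nu < +oo)%E.
Proof.
move=> muP nuP; have [W [[[p [Wp po]] [q [Wq qo]]] _]] := H_conv muP nuP P2_base.
have [_ W2 pE] := pushes_coupling (@measurable_x1 R n.+1) (@measurable_x2 R n.+1) Wp po.
have [_ W3 qE] := pushes_coupling (@measurable_x1 R n.+1) (@measurable_x3 R n.+1) Wq qo.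
apply: (le_lt_trans (W2sq_le (@measurable_x2 R n.+1) (@measurable_x3 R n.+1) W2 W3)).
apply: (integral_sqdist_triangle (@measurable_x2 R n.+1) (@measurable_x1 R n.+1)
  (@measurable_x3 R n.+1)); last by rewrite qE W2sqC.
by under eq_integral do rewrite sqdistC; rewrite pE W2sqC.
Qed.

Lemma W2sq_fin mu nu : P2 omega0 mu -> P2 omega0 nu ->
  W2sq mu nu = (fine (W2sq mu nu))%:E.
Proof.
by move=> muP nuP; rewrite fineK// ge0_fin_numE ?W2sq_ge0// W2sq_P2_lty.
Qed.

Lemma domE_fin mu : domE omega0 E mu -> E mu = (fine (E mu))%:E.
Proof.
move=> [muP muoo]; rewrite fineK// fin_numE E_noninf//=.
by move: muoo; rewrite ltey.
Qed.

Lemma PhiE (tau : R) mu nu (w e : R) : W2sq mu nu = w%:E -> E nu = e%:E ->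
  Phi E tau mu nu = (w * (2 * tau)^-1 + e)%:E.
Proof. by rewrite /Phi => -> ->; rewrite -EFinM -EFinD. Qed.

(** Convexity supplies a plan with base [nu], which contains an optimal coupling of [nu] and [mu];
    as [nu] does not charge small sets, that coupling is carried by a map. *)
Lemma otmap_exists nu mu : domE omega0 E nu -> P2 omega0 mu -> exists t, otmap nu mu t.
Proof.
move=> nuD muP; have nuP := nuD.1.
have [W [[[p [_ po]] _] _]] := H_conv muP muP nuP.
have [t [mt pt _]] := optimal_coupling_map (H_dom nuD) (W2sq_P2_lty nuP muP) po po.
have [[p1 p2] pE] := po.
have mtz : measurable_fun setT (fun z : T * T => t z.1).
  exact: measurableT_comp mt measurable_fst.
exists t; split => //; split.
  move=> A mA.
  rewrite -(pushes_ae_eq measurable_snd mtz pt p2 mA) -p1//.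
  by rewrite -[X in measurable X]setTI; exact: mt.
rewrite -pE (integral_sqdist_pushes p1 measurable_fst (@measurable_id _ _ _) mt).
apply: integral_sqdist_ae => //.
- by apply: nearW.
- by apply: filterS pt => z ->.
Qed.

(** The coupling induced by [t] is itself optimal, and two optimal couplings share one map, which
    must be [t] almost everywhere. *)
Lemma otmap_ae nu mu t p : domE omega0 E nu -> P2 omega0 mu ->
  otmap nu mu t -> opt_coupling nu mu p -> {ae p, forall z : T * T, z.2 = t z.1}.
Proof.
move=> nuD muP ot po; have [mt _] := ot; have [[p1 p2] pE] := po.
have [q [nuq qo]] := opt_coupling_otmap ot.
have [t' [mt' pt' qt']] := optimal_coupling_map (H_dom nuD) (W2sq_P2_lty nuD.1 muP) po qo.
have tt' := ae_pushes nuq (measurable_fun_pair (@measurable_id _ _ _) mt) qt'.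
have := ae_pushes p1 measurable_fst tt'.
by apply: filterS2 pt' => z -> /= ->.
Qed.

Lemma otmap_lty nu mu t : P2 omega0 nu -> P2 omega0 mu -> otmap nu mu t ->
  (\int[nu]_x (sqdist x (t x))%:E < +oo)%E.
Proof. by move=> nuP muP [_ [_ ->]]; exact: W2sq_P2_lty. Qed.

Lemma geodesic_energy (W : probability (T * T * T)%type R) nu nu' mua (a b : R) :
  domE omega0 E nu -> domE omega0 E nu' -> P2 omega0 mua -> W2plan_sq W = b%:E ->
  (E mua <= (1 - a)%:E * E nu + a%:E * E nu'
            - (a * (1 - a) * (lambda / 2))%:E * W2plan_sq W)%E ->
  domE omega0 E mua /\
  fine (E mua) <= (1 - a) * fine (E nu) + a * fine (E nu') - a * (1 - a) * (lambda / 2) * b.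
Proof.
move=> nuD nuD' aP ->; rewrite (domE_fin nuD) (domE_fin nuD').
rewrite -!EFinM -!EFinD => H.
have aD : domE omega0 E mua by split => //; exact: le_lt_trans H (ltry _).
by split => //; rewrite (domE_fin aD) lee_fin in H.
Qed.

(* [t] pulls the base [mu] of the generalized geodesic back to [nu], so that the
   geodesic becomes a segment of maps starting at the identity on [nu]. *)
Lemma strong_subdiff_variational mu nu nu' (tau : R) (t : T -> T) :
  0 < tau -> domE omega0 E mu -> domE omega0 E nu' -> otmap nu mu t ->
  strong_subdiff omega0 E lambda nu (fun x => tau^-1 *: ((t x : 'rV[R]_n.+1) - x)) ->
  exists b : R, [/\ 0 <= b, b = 0 -> same_measure nu' nu &
    lambda / 2 * b + tau^-1 * (2^-1 * (fine (W2sq mu nu) + b - fine (W2sq mu nu')))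
    <= fine (E nu') - fine (E nu)].
Proof.
move=> tau0 muD nu'D ot [[nuD _] strong].
have [muP nuP nu'P] := And3 muD.1 nuD.1 nu'D.1.
have [W [Wt Wconv]] := H_conv nuP nu'P muP.
have [[p [Wp po]] [q [Wq qo]]] := Wt.
have mx1 := @measurable_x1 R n.+1; have mx2 := @measurable_x2 R n.+1.
have mx3 := @measurable_x3 R n.+1.
have [p' [pp' po']] := opt_coupling_swap po.
have [mt [tmu tE]] := ot.
(* The exchanged marginal [(x2, x1)] is an optimal coupling of [nu] with [mu], hence carried by
   [t]. *)
have Wx1 : {ae W, forall z, z.1.1 = t z.1.2}.
  have := otmap_ae nuD muP ot po'.
  move=> /(ae_pushes pp' (measurable_fun_pair measurable_snd measurable_fst)).
  by move=> /(ae_pushes Wp (measurable_fun_pair mx1 mx2)).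
(* [mu] lies in the domain as well, so [(x1, x3)] is carried by a map [t'], and [x3 = t' (t x2)]. *)
have [t' [mt' qt' _]] := optimal_coupling_map (H_dom muD) (W2sq_P2_lty muP nu'P) qo qo.
have Wx3' : {ae W, forall z, z.2 = t' z.1.1}.
  by move: qt' => /(ae_pushes Wq (measurable_fun_pair mx1 mx3)).
pose s : T -> T := t' \o t.
have ms : measurable_fun setT s by exact: measurableT_comp mt' mt.
have Wx3 : {ae W, forall z, z.2 = s z.1.2}.
  by apply: filterS2 Wx1 Wx3' => z h1 h3; rewrite h3 h1.
have [Wplan snu' Wmid] := plan_of_map ms Wt Wx3.
have [_ W2 pE] := pushes_coupling mx1 mx2 Wp po.
have [_ W3 qE] := pushes_coupling mx1 mx3 Wq qo.
have planoo : (W2plan_sq W < +oo)%E.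
  apply: (integral_sqdist_triangle mx2 mx1 mx3); last by rewrite qE W2sq_P2_lty.
  by under eq_integral do rewrite sqdistC; rewrite pE W2sq_P2_lty.
have soo : (\int[nu]_x (sqdist x (s x))%:E < +oo)%E by rewrite -Wplan.
have too := otmap_lty nuP muP ot.
(* Along the plan [(t x2, s x2)] is [(x1, x3)], which couples [mu] and [nu'] optimally. *)
have tsE : (\int[nu]_x (sqdist (t x) (s x))%:E = W2sq mu nu')%E.
  rewrite -qE (integral_sqdist_pushes W2 mx2 mt ms); apply: integral_sqdist_ae => //.
  - exact: measurableT_comp mt mx2.
  - exact: measurableT_comp ms mx2.
  - by apply: filterS Wx1 => z ->.
  - by apply: filterS Wx3 => z ->.
pose b := fine (\int[nu]_x (sqdist x (s x))%:E).
have bE : (\int[nu]_x (sqdist x (s x))%:E)%E = b%:E by exact: integral_sqdist_fin.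
have b0 : 0 <= b by exact/fine_ge0/integral_sqdist_ge0.
exists b; split => //.
  move=> bz; have : (\int[nu]_x (sqdist x (s x))%:E = 0)%E by rewrite bE bz.
  move=> /(integral_sqdist_eq0 (@measurable_id _ _ _) ms) idse B mB.
  have sid : {ae nu, forall x, s x = x} by apply: filterS idse => x h; rewrite -h.
  exact/esym/(pushes_ae_eq ms (@measurable_id _ _ _) sid snu').
apply: small_step_limit => // eps eps0.
have [delta [delta0 Hdelta]] := strong eps eps0.
exists delta; split => // a /andP[a0 a1] abdelta.
have [mua [Wa nua]] := Wmid a.
have mta := measurable_interp_map a ms.
have taE := integral_sqdist_interp_map_id ms soo a.
have aP : P2 omega0 mua.
  apply: P2_pushes nuP mta nua _.
  by under eq_integral do rewrite sqdistC; rewrite taE ltry.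
have a01 : 0 <= a <= 1 by rewrite (ltW a0) (ltW a1).
have [aD convE] := geodesic_energy nuD nu'D aP (etrans Wplan bE) (Wconv a a01 mua Wa).
have := Hdelta _ mua mta nua; rewrite /L2sq taE lte_fin => /(_ abdelta).
rewrite (integral_inner_interp_map _ _ mt ms too soo) (domE_fin aD) (domE_fin nuD).
rewrite -!EFinB lee_fin /= tE tsE -/b (W2sqC nu mu).
rewrite sqrtrM ?sqr_ge0// sqrtr_sqr gtr0_norm//.
set k := 2^-1 * _ => sub.
rewrite -(ler_pM2l a0); exact: strong_step_arith sub convE.
Qed.

Section minimizer.
Variables (mu nu : probability T R) (tau : R) (t : T -> T).
Hypotheses (tau0 : 0 < tau) (muP : P2 omega0 mu) (nuD : domE omega0 E nu).
Hypothesis nu_min : forall nu', P2 omega0 nu' -> (Phi E tau mu nu <= Phi E tau mu nu')%E.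
Hypothesis ot : otmap nu mu t.

Let nuP : P2 omega0 nu := nuD.1.
Let mt : measurable_fun setT t := ot.1.
Let too := otmap_lty nuP muP ot.

(** The pair [(t, f)] on [nu] couples [mu] with [nu1], which bounds the squared distance in [Phi]
    from above. *)
Lemma minimizer_pushes (f : T -> T) nu1 : measurable_fun setT f -> pushes nu f nu1 ->
  (\int[nu]_x (sqdist x (f x))%:E < +oo)%E -> domE omega0 E nu1 ->
  fine (W2sq mu nu) * (2 * tau)^-1 + fine (E nu) <=
  fine (\int[nu]_x (sqdist (t x) (f x))%:E) * (2 * tau)^-1 + fine (E nu1).
Proof.
move=> mf fnu1 foo nu1D; have nu1P := nu1D.1.
have := nu_min nu1P.
rewrite (PhiE tau (W2sq_fin muP nuP) (domE_fin nuD)).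
rewrite (PhiE tau (W2sq_fin muP nu1P) (domE_fin nu1D)) lee_fin => /le_trans; apply.
rewrite lerD2r ler_wpM2r//; first by rewrite invr_ge0 mulr_ge0// ltW.
rewrite -lee_fin -(W2sq_fin muP nu1P) -(integral_sqdist_maps mt mf too foo).
by apply: (W2sq_le mt mf) fnu1; exact: ot.2.1.
Qed.

Lemma minimizer_subdiff :
  subdiff omega0 E lambda nu (fun x => tau^-1 *: ((t x : 'rV[R]_n.+1) - x)).
Proof.
split => //; split.
  split.
    by apply: measurable_rVZ; apply: measurable_rVB.
  rewrite /L2sq.
  rewrite (_ : integral _ _ _ = \int[nu]_x ((tau^-1 ^+ 2)%:E * (sqdist x (t x))%:E))%E.
    by rewrite integralZl//; [rewrite integral_sqdist_fin// -EFinM ltry|exact: integrable_sqdist].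
  by apply: eq_integral => x _; rewrite sqdistZ0 EFinM (sqdistC x).
move=> nu' s nu'D os; have nu'P := nu'D.1; have [ms [snu' sE]] := os.
have soo := otmap_lty nuP nu'P os.
(* Taking [nu] itself as base forces [x1 = x2], so the plan is the geodesic from [nu] to [nu'] along
   the optimal map [s]. *)
have [W [Wt Wconv]] := H_conv nuP nu'P nuP.
have [[p [Wp po]] [q [Wq qo]]] := Wt.
have mx1 := @measurable_x1 R n.+1; have mx2 := @measurable_x2 R n.+1.
have mx3 := @measurable_x3 R n.+1.
have [_ _ pE] := pushes_coupling mx1 mx2 Wp po.
have Wx12 : {ae W, forall z, z.1.1 = z.1.2}.
  by apply: integral_sqdist_eq0 mx1 mx2 _; rewrite pE W2sqxx.
have Wx3 : {ae W, forall z, z.2 = s z.1.2}.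
  have /(ae_pushes Wq (measurable_fun_pair mx1 mx3)) := otmap_ae nuD nu'P os qo.
  by apply: filterS2 Wx12 => z /= ->.
have [Wplan _ Wmid] := plan_of_map ms Wt Wx3.
pose b := fine (\int[nu]_x (sqdist x (s x))%:E).
have bE : (\int[nu]_x (sqdist x (s x))%:E)%E = b%:E by exact: integral_sqdist_fin.
have b0 : 0 <= b by exact/fine_ge0/integral_sqdist_ge0.
rewrite (integral_inner_map mt ms too soo) -sE bE (domE_fin nuD) (domE_fin nu'D).
rewrite -EFinM -EFinD -EFinB lee_fin /= -/b.
set A := fine _; set C := fine (\int[nu]_x (sqdist (t x) (s x))%:E)%E.
have AE : fine (W2sq mu nu) = A by rewrite /A ot.2.2 W2sqC.
(* The part [tau^-1 * b / 2] of the polarized inner product joins [lambda / 2 * b], matching the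
   modulus that minimality along the segment provides. *)
suff : (lambda + tau^-1) / 2 * b + tau^-1 * (2^-1 * (A - C)) <= fine (E nu') - fine (E nu).
  by lra.
apply: small_step_limit => // eps eps0; exists 1; split => // a /andP[a0 a1] _.
have [mua [Wa nua]] := Wmid a.
have mta := measurable_interp_map a ms.
have taoo : (\int[nu]_x (sqdist x (interp_map a s x))%:E < +oo)%E.
  under eq_integral do rewrite sqdistC.
  by rewrite (integral_sqdist_interp_map_id ms soo) ltry.
have a01 : 0 <= a <= 1 by rewrite (ltW a0) (ltW a1).
have [aD convE] := geodesic_energy nuD nu'D (P2_pushes nuP mta nua taoo)
  (etrans Wplan bE) (Wconv a a01 mua Wa).
have := minimizer_pushes mta nua taoo aD.
rewrite (integral_sqdist_interp_map mt ms too soo) /= AE -/A -/b -/C invfM => minE.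
apply: (@le_trans _ _ ((1 - a) * ((lambda + tau^-1) / 2) * b + tau^-1 * (2^-1 * (A - C)))).
  by rewrite gerBl mulr_ge0// ltW.
rewrite -(ler_pM2l a0); exact: minimizing_step_arith minE convE.
Qed.

Lemma minimizer_strong_subdiff :
  strong_subdiff omega0 E lambda nu (fun x => tau^-1 *: ((t x : 'rV[R]_n.+1) - x)).
Proof.
split; first exact: minimizer_subdiff.
(* The error is [B / (2 * tau)] with [B] the squared displacement; it is at most [eps * sqrt B] once
   [sqrt B <= 2 * tau * eps]. *)
move=> eps eps0; exists (2 * tau * eps); split; first by rewrite !mulr_gt0.
move=> f nu1 mf fnu1; rewrite /L2sq => fdelta.
have fC : (\int[nu]_x (sqdist (f x) (id x))%:E = \int[nu]_x (sqdist x (f x))%:E)%E.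
  by apply: eq_integral => x _; rewrite sqdistC.
rewrite fC in fdelta *.
have foo : (\int[nu]_x (sqdist x (f x))%:E < +oo)%E by exact: lt_trans fdelta (ltry _).
have nu1P : P2 omega0 nu1 by exact: P2_pushes nuP mf fnu1 foo.
rewrite (integral_inner_map mt mf too foo) (domE_fin nuD).
have [Eoo|Eoo] := eqVneq (E nu1) +oo%E; first by rewrite Eoo addye// leey.
have nu1D : domE omega0 E nu1 by split => //; rewrite ltey.
have := minimizer_pushes mf fnu1 foo nu1D.
move: fdelta; rewrite (integral_sqdist_fin foo) (domE_fin nu1D) -!EFinB lte_fin lee_fin /=.
have AE : fine (W2sq mu nu) = fine (\int[nu]_x (sqdist x (t x))%:E) by rewrite ot.2.2 W2sqC.
rewrite AE invfM.
set A := fine (\int[nu]_x (sqdist x (t x))%:E)%E.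
set B := fine (\int[nu]_x (sqdist x (f x))%:E)%E.
set C := fine (\int[nu]_x (sqdist (t x) (f x))%:E)%E => Bdelta minE.
have B0 : 0 <= B by exact/fine_ge0/integral_sqdist_ge0.
have r0 := sqrtr_ge0 B.
have rdelta : Num.sqrt B <= 2 * tau * eps.
  rewrite -(ger0_norm (ltW (mulr_gt0 (mulr_gt0 _ tau0) eps0)))// -sqrtr_sqr.
  exact/ler_wsqrtr/ltW.
have Br : B * tau^-1 <= 2 * eps * Num.sqrt B.
  rewrite ler_pdivrMr// -[leLHS](sqr_sqrtr B0) expr2.
  by apply: le_trans (ler_wpM2l r0 rdelta) _; rewrite le_eqVlt; apply/orP; left; apply/eqP; ring.
move: minE Br; lra.
Qed.

End minimizer.

(** Against the competitor [mu] the distance vanishes, and [Phi] equals the finite [E mu]. *)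
Lemma minimizer_domE mu nu (tau : R) : 0 < tau -> domE omega0 E mu -> P2 omega0 nu ->
  (Phi E tau mu nu <= Phi E tau mu mu)%E -> domE omega0 E nu.
Proof.
move=> tau0 muD nuP; rewrite /Phi W2sqxx mul0e add0e => H; split => //.
apply: le_lt_trans muD.2; apply: le_trans H.
by rewrite leeDr// mule_ge0 ?W2sq_ge0// lee_fin invr_ge0 mulr_ge0// ltW.
Qed.

(** The variational inequality bounds the difference of [Phi] from below by
    [(lambda + tau^-1) / 2 * b]; a tie forces [b = 0]. *)
Lemma Phi_strong_subdiff_ge mu nu nu' (tau : R) (t : T -> T) :
  0 < tau -> tau * Num.max 0 (- lambda) < 1 ->
  domE omega0 E mu -> domE omega0 E nu' -> otmap nu mu t ->
  strong_subdiff omega0 E lambda nu (fun x => tau^-1 *: ((t x : 'rV[R]_n.+1) - x)) ->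
  (Phi E tau mu nu <= Phi E tau mu nu')%E /\
  ((Phi E tau mu nu' <= Phi E tau mu nu)%E -> same_measure nu' nu).
Proof.
move=> tau0 taul muD nu'D ot ss; have nuD := ss.1.1.
have [b [b0 bsame]] := strong_subdiff_variational tau0 muD nu'D ot ss.
rewrite (PhiE tau (W2sq_fin muD.1 nuD.1) (domE_fin nuD)).
rewrite (PhiE tau (W2sq_fin muD.1 nu'D.1) (domE_fin nu'D)) !lee_fin invfM.
move: (fine (W2sq mu nu)) (fine (W2sq mu nu')) (fine (E nu)) (fine (E nu')) => A C e e' H.
(* The bound [tau < 1 / lambda^-] makes the modulus strictly positive. *)
have l0 : 0 < lambda + tau^-1.
  have : - lambda < tau^-1.
    rewrite -[ltRHS]mul1r ltr_pdivlMr// mulrC; apply: le_lt_trans taul.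
    by rewrite ler_wpM2l ?(ltW tau0)// le_max lexx orbT.
  by lra.
have lb : 0 <= (lambda + tau^-1) * b by rewrite mulr_ge0// ltW.
split; first by move: H lb; lra.
move=> H2; apply: bsame; apply/eqP; rewrite eq_le b0 andbT.
rewrite -(pmulr_rle0 _ l0); move: H H2; lra.
Qed.

End proximal_step.

(** The step-size condition is [tau < 1 / lambda^-] cleared of its denominator, so that
    [lambda^- = 0] allows every positive [tau]. *)
Theorem theorem1p23 (R : realType) (d : nat) (hd : (0 < d)%N)
  (omega0 : probability (Rd R d) R) (E : probability (Rd R d) R -> \bar R)
  (lambda : R)
  (* E takes values in R \cup {+oo} on P_{2,omega0} *)
  (E_noninf : forall mu, P2 omega0 mu -> E mu != -oo%E)
  (* E is a function of the measure (not of its representation) *)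
  (E_wd : forall mu nu, same_measure mu nu -> E mu = E nu)
  (* domain assumption *)
  (H_dom : forall mu, domE omega0 E mu -> no_small_sets mu)
  (* convexity assumption *)
  (H_proper : proper_fun omega0 E) (H_coer : coercive omega0 E)
  (H_lsc : lsc_W2 omega0 E) (H_conv : gen_geod_convex omega0 E lambda)
  (mu : probability (Rd R d) R) (Hmu : domE omega0 E mu)
  (tau : R) (Htau0 : 0 < tau) (Htau : tau * Num.max 0 (- lambda) < 1)
  (nu : probability (Rd R d) R) (Hnu : P2 omega0 nu) :
  unique_minimizer omega0 E tau mu nu <->
  exists t : Rd R d -> Rd R d, otmap nu mu t /\
    strong_subdiff omega0 E lambda nu (fun x => tau^-1 *: ((t x : 'rV[R]_d) - x)).
Proof.
(* Writing the dimension as [n.+1] lets a coordinate be singled out and makes the Hausdorff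
   dimension [n]. *)
case: d hd omega0 E E_noninf E_wd H_dom H_proper H_coer H_lsc H_conv mu Hmu nu Hnu => // n _.
move=> omega0 E E_noninf _ H_dom _ _ _ H_conv mu Hmu nu Hnu; split.
  move=> [_ [nu_min _]].
  have nuD := minimizer_domE Htau0 Hmu Hnu (nu_min mu Hmu.1).
  have [t ot] := otmap_exists H_dom H_conv nuD Hmu.1.
  exists t; split => //.
  exact: (minimizer_strong_subdiff E_noninf H_dom H_conv Htau0 Hmu.1 nuD nu_min ot).
move=> [t [ot ss]]; have nuD := ss.1.1.
have Phi_oo nu' : P2 omega0 nu' -> (Phi E tau mu nu' < +oo)%E -> domE omega0 E nu'.
  move=> nu'P; rewrite /Phi => h; split => //; apply: le_lt_trans h.
  by rewrite leeDr// mule_ge0 ?W2sq_ge0// lee_fin invr_ge0 mulr_ge0// ltW.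
have main nu' nu'D :=
  Phi_strong_subdiff_ge E_noninf H_dom H_conv (nu' := nu') Htau0 Htau Hmu nu'D ot ss.
have nu_min nu' : P2 omega0 nu' -> (Phi E tau mu nu <= Phi E tau mu nu')%E.
  move=> nu'P; have [/(Phi_oo _ nu'P) nu'D|] := ltP (Phi E tau mu nu') +oo%E.
    exact: (main nu' nu'D).1.
  by rewrite leye_eq => /eqP ->; rewrite leey.
split => //; split => // nu' nu'P nu'_min.
have nu'D : domE omega0 E nu'.
  by apply: (minimizer_domE Htau0 Hmu nu'P); exact: nu'_min Hmu.1.
by apply: (main nu' nu'D).2; exact: nu'_min.
Qed.
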